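(* Let either $a>0$ and $b>0$ be real, or $a\in\mathbb{C}\setminus\{0\}$ with $\mathrm{Re}\,a>0$ and $b=\overline{a}$. Let $k\in\mathbb{N}$ and $\alpha\in\mathbb{C}$. Suppose that at least one of the following two conditions holds: (i) $ab\leq\min\left\{\frac12,\frac{a+b}{3}\right\}$ and $|\alpha|\,(B(a,b)-1)\leq 1$; (ii) $ab\geq\max\left\{\frac12,\frac{a+b}{3}\right\}$ and $|\alpha|\leq B(a,b)-1$. For $z\in\mathbb{D}$ let $$f(z)=zF(a,b;a+b;z^2)+\overline{\frac{\alpha z^{2k+1}}{2k+1}\Big\{F(a,b;a+b;z^2)\ast F(2,2k+1;2k+2;z)\Big\}}$$ and $$t(z)=2\,\mathrm{Im}\Big\{\frac{\sqrt{\alpha}\,z^{k+1}}{k+1}\big[F(a,b;a+b;z^2)\ast F(2,k+1;k+2;z)\big]\Big\}+c,\qquad c\in\mathbb{R}.$$ Then the formula $(\mathrm{Re}\,f(z),\mathrm{Im}\,f(z),t(z))$, $z\in\mathbb{D}$, defines a minimal surface whose projection is $f(z)$.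
   Context: $\mathbb{D}=\{z\in\mathbb{C}:|z|<1\}$, $\mathbb{N}=\{1,2,\dots\}$. $F(a,b;c;z)=\sum_{n=0}^{\infty}\frac{(a,n)(b,n)}{(c,n)(1,n)}z^n$ is the Gaussian hypergeometric function, where $(a,0)=1$ and $(a,n)=a(a+1)\cdots(a+n-1)$ for $n\ge1$. $B(a,b)=\Gamma(a)\Gamma(b)/\Gamma(a+b)$ is the beta function. $\ast$ is the Hadamard product of power series in $z$: $(\sum c_nz^n)\ast(\sum d_nz^n)=\sum c_nd_nz^n$ (with $F(a,b;a+b;z^2)$ regarded as a power series in $z$). $\sqrt{\alpha}$ denotes a fixed square root of $\alpha$ and $c$ an arbitrary real constant. The surface lies in $\mathbb{R}^3$ and is parametrized by $z\in\mathbb{D}$; its projection is the projection $(u,v,t)\mapsto u+iv$ onto the base plane. *)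

(* Defs.v *)
From Stdlib Require Export Reals List.
From Coquelicot Require Export Coquelicot.
Open Scope R_scope.

(** * Gamma and beta functions on the right half-plane *)

(** [t ^ s] for real [t > 0], with the real logarithm of [t]. *)
Definition Cpower (t : R) (s : C) : C :=
  (Rpower t (Re s) * cos (Im s * ln t), Rpower t (Re s) * sin (Im s * ln t)).

(** Euler's integral, improper at both ends; meaningful for [0 < Re s]. *)
Definition Gamma (s : C) : C :=
  RInt_gen (V := C_R_CompleteNormedModule)
    (fun t : R => (exp (- t) * Cpower t (s - 1))%C)
    (at_right 0) (Rbar_locally p_infty).

Definition Beta (a b : C) : C := (Gamma a * Gamma b / Gamma (a + b))%C.

(** * Complex power series, given by their coefficient sequences *)

(** The sum is an unspecified value where the series diverges. *)
Definition CPSeries (u : nat -> C) (z : C) : C :=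
  iota (T := C_CompleteNormedModule)
    (fun l : C => is_pseries (K := C_AbsRing) (V := C_NormedModule) u z l).

Definition hadamard (u v : nat -> C) (n : nat) : C := (u n * v n)%C.

(** Coefficients, as a power series in [z], of [sum_n u n * (z^2)^n]. *)
Definition in_square (u : nat -> C) (n : nat) : C :=
  if Nat.even n then u (Nat.div2 n) else 0%C.

Fixpoint poch (a : C) (n : nat) : C :=
  match n with
  | O => 1%C
  | S m => (poch a m * (a + INR m))%C
  end.

Definition hyp_coef (a b c : C) (n : nat) : C :=
  (poch a n * poch b n / (poch c n * poch 1 n))%C.

Definition hypF (a b c z : C) : C := CPSeries (hyp_coef a b c) z.

(** * Parametrized surfaces in R^3, with parameter [z = x + i y] *)

Definition unit_disk (z : C) : Prop := Cmod z < 1.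

Inductive var := vx | vy.

Definition slice (i : var) (g : C -> R) (z : C) : R -> R :=
  match i with
  | vx => fun x => g (x, Im z)
  | vy => fun y => g (Re z, y)
  end.

Definition coord (i : var) (z : C) : R :=
  match i with vx => Re z | vy => Im z end.

Definition partial (i : var) (g : C -> R) (z : C) : R :=
  Derive (slice i g z) (coord i z).

(** C^infinity on [D] (an open set): all iterated partial derivatives, in any
    order, exist and are continuous. *)
Definition smooth_on (D : C -> Prop) (g : C -> R) : Prop :=
  forall (w : list var) (z : C), D z ->
    let h := fold_right partial g w in
    continuous (T := C_UniformSpace) h z /\
    forall i : var, ex_derive (slice i h z) (coord i z).

Definition R3 : Type := (R * R * R)%type.
Definition p1 (p : R3) : R := fst (fst p).
Definition p2 (p : R3) : R := snd (fst p).
Definition p3 (p : R3) : R := snd p.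

Definition dot (p q : R3) : R := p1 p * p1 q + p2 p * p2 q + p3 p * p3 q.

Definition cross (p q : R3) : R3 :=
  (p2 p * p3 q - p3 p * p2 q,
   p3 p * p1 q - p1 p * p3 q,
   p1 p * p2 q - p2 p * p1 q).

Definition scal3 (r : R) (p : R3) : R3 := (r * p1 p, r * p2 p, r * p3 p).

Definition partial3 (i : var) (X : C -> R3) (z : C) : R3 :=
  (partial i (fun w => p1 (X w)) z,
   partial i (fun w => p2 (X w)) z,
   partial i (fun w => p3 (X w)) z).

Definition normal (X : C -> R3) (z : C) : R3 :=
  cross (partial3 vx X z) (partial3 vy X z).

Definition unit_normal (X : C -> R3) (z : C) : R3 :=
  scal3 (/ sqrt (dot (normal X z) (normal X z))) (normal X z).

Definition fund1 (X : C -> R3) (i j : var) (z : C) : R :=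
  dot (partial3 i X z) (partial3 j X z).

Definition fund2 (X : C -> R3) (i j : var) (z : C) : R :=
  dot (partial3 i (partial3 j X) z) (unit_normal X z).

(** [(E n - 2 F m + G l) / (2 (E G - F^2))]. *)
Definition mean_curvature (X : C -> R3) (z : C) : R :=
  (fund1 X vx vx z * fund2 X vy vy z
   - 2 * fund1 X vx vy z * fund2 X vx vy z
   + fund1 X vy vy z * fund2 X vx vx z)
  / (2 * (fund1 X vx vx z * fund1 X vy vy z - fund1 X vx vy z ^ 2)).

Definition regular_surface (D : C -> Prop) (X : C -> R3) : Prop :=
  smooth_on D (fun z => p1 (X z)) /\
  smooth_on D (fun z => p2 (X z)) /\
  smooth_on D (fun z => p3 (X z)) /\
  forall z, D z -> normal X z <> (0, 0, 0).

Definition minimal_surface (D : C -> Prop) (X : C -> R3) : Prop :=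
  regular_surface D X /\ forall z, D z -> mean_curvature X z = 0.

Definition base_projection (p : R3) : C := (p1 p, p2 p).

(* Main.v *)
Require Import Defs.
From Stdlib Require Import Reals.
From Stdlib Require Import Lra Lia.
From Coquelicot Require Import Coquelicot.
Open Scope R_scope.

(** The surface is given by its Weierstrass representation.  Write
    [F(a, b; a + b; z) = sum_n A_n z ^ n], [h(z) = z F(a, b; a + b; z ^ 2)] and
    [Q = h'].  The factor [F(2, j; j + 1; z)] has the coefficients
    [(n + 1) j / (j + n)], so the Hadamard product with it turns
    [beta z ^ j / j * ...] into the primitive of [beta z ^ (j - 1) Q]
    ([component_derivative]).  With [r = sqrt_alpha z ^ k], the coordinates are
    thus, up to a translation, the real parts of the primitives of
      [phi1 = Q (1 + r^2)], [phi2 = -i Q (1 - r^2)], [phi3 = -2 i r Q],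
    and [phi1^2 + phi2^2 + phi3^2 = 0].  Hence the coordinates are harmonic and
    the parameter is conformal, and the mean curvature vanishes
    ([isotropic_minimal_surface]).  The surface is regular because [Q] has no
    zero in the disk, for [phi1 = phi2 = 0] only where [Q = 0].

    That [Q] has no zero is the point at which the hypotheses on [a] and [b]
    enter.  With [B_n = (2 n + 1) A_n], [Q(z) = sum_n B_n z ^ (2 n)], and the
    sign of [B_{n+1} - B_n] is that of [(2 a b - 1) n + (3 a b - a - b)].  In
    case (i) the positive [B_n] decrease from [1]; in case (ii) they increase
    from [1] to [2 / Beta a b], which is at most [2] since [Beta a b >= 1].  In
    both cases the total variation is at most [1], and then the equation
    [(1 - w) sum_n B_n w ^ n = 1 + sum_n (B_{n+1} - B_n) w ^ (n + 1)] excludes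
    zeros with [|w| < 1] ([small_variation_nonvanishing]).

    The bound [B_n <= 2 + 1 / n] in case (ii) is where the Gamma function
    comes in ([hyp_coef_beta_bound]): by the functional equation,
    [A_n Beta a b = Gamma (a + n) Gamma (b + n) / (Gamma (a + b + n) n!)], and
    [|Gamma s| <= Gamma (Re s)] together with the log-convexity of [Gamma] on
    the positive reals bounds this by [1 / n]. *)

(** * Complex power series on the unit disk *)

Definition csum (u : nat -> C) (l : C) : Prop :=
  is_series (K := C_AbsRing) (V := C_NormedModule) u l.

Lemma csum_partial_sums (u : nat -> C) (l : C) :
  csum u l -> is_lim_seq (fun N => Cmod (sum_n (G := C_AbelianMonoid) u N)) (Cmod l).
Proof.
  intros H.
  unfold is_lim_seq.
  apply (filterlim_comp nat C R (sum_n (G := C_AbelianMonoid) u) Cmod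
           eventually (locally (T := C_UniformSpace) l)).
  - exact H.
  - exact (filterlim_norm (K := C_AbsRing) (V := C_NormedModule) l).
Qed.

Lemma csum_norm_le (u : nat -> C) (v : nat -> R) (l : C) (L : R) :
  (forall n, Cmod (u n) <= v n) -> csum u l -> is_series v L -> Cmod l <= L.
Proof.
  intros Hle Hu Hv.
  apply (is_lim_seq_le (fun N => Cmod (sum_n (G := C_AbelianMonoid) u N)) (sum_n v) (Cmod l) L).
  - intros N.
    eapply Rle_trans.
    apply (norm_sum_n_m (K := C_AbsRing) (V := C_NormedModule) u 0 N).
    apply (sum_n_m_le (fun k => @norm C_AbsRing C_NormedModule (u k)) v 0 N Hle).
  - now apply csum_partial_sums.
  - exact Hv.
Qed.

Lemma csum_unique (u : nat -> C) (l l' : C) : csum u l -> csum u l' -> l = l'.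
Proof.
  intros H H'.
  exact (filterlim_locally_unique (K := C_AbsRing) (V := C_NormedModule)
           (F := eventually) (sum_n (G := C_AbelianMonoid) u) l l' H H').
Qed.

(** This says that the radius of convergence is at least one, in a form that
    passes to sums and multiples at once. *)
Definition unit_radius (u : nat -> C) : Prop :=
  forall r, 0 <= r < 1 -> ex_series (fun n => Cmod (u n) * r ^ n).

Lemma bounded_unit_radius (u : nat -> C) (M : R) :
  (forall n, Cmod (u n) <= M) -> unit_radius u.
Proof.
  intros H r Hr.
  apply (ex_series_le (K := R_AbsRing) (V := R_CompleteNormedModule)) with (fun n => M * r ^ n).
  - intros n; unfold norm; simpl; unfold abs; simpl.
    assert (0 <= r ^ n) by (apply pow_le; lra).
    rewrite Rabs_pos_eq by (apply Rmult_le_pos; [apply Cmod_ge_0|assumption]).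
    now apply Rmult_le_compat_r.
  - apply (ex_series_scal_l (K := R_AbsRing) (V := R_NormedModule) M (fun n => r ^ n)).
    apply ex_series_geom; rewrite Rabs_pos_eq; lra.
Qed.

Lemma unit_radius_comb (x y : C) (u v : nat -> C) :
  unit_radius u -> unit_radius v -> unit_radius (fun n => (x * u n + y * v n)%C).
Proof.
  intros Hu Hv r Hr.
  apply (ex_series_le (K := R_AbsRing) (V := R_CompleteNormedModule))
    with (fun n => Cmod x * (Cmod (u n) * r ^ n) + Cmod y * (Cmod (v n) * r ^ n)).
  - intros n; unfold norm; simpl; unfold abs; simpl.
    assert (0 <= r ^ n) by (apply pow_le; lra).
    rewrite Rabs_pos_eq by (apply Rmult_le_pos; [apply Cmod_ge_0|assumption]).
    rewrite <- !Rmult_assoc, <- Rmult_plus_distr_r, <- !Cmod_mult.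
    apply Rmult_le_compat_r; [assumption|apply Cmod_triangle].
  - apply (ex_series_plus (K := R_AbsRing) (V := R_NormedModule));
    apply (ex_series_scal_l (K := R_AbsRing) (V := R_NormedModule)); auto.
Qed.

Lemma unit_radius_scal (x : C) (u : nat -> C) :
  unit_radius u -> unit_radius (fun n => (x * u n)%C).
Proof.
  intros Hu r Hr.
  apply ex_series_ext with (fun n => Cmod (x * u n + 0 * u n) * r ^ n).
  - intros n; do 2 f_equal; ring.
  - now apply unit_radius_comb.
Qed.

Definition deriv_coef (u : nat -> C) (n : nat) : C := (INR (S n) * u (S n))%C.

(** Differentiation does not change the radius of convergence; the moduli of
    the coefficients form a real power series, for which this is known. *)
Lemma unit_radius_deriv (u : nat -> C) : unit_radius u -> unit_radius (deriv_coef u).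
Proof.
  intros Hu r Hr.
  set (a := fun n => Cmod (u n)).
  assert (Hr' : 0 <= (1 + r) / 2 < 1) by lra.
  assert (Hrad : Rbar_le ((1 + r) / 2) (CV_radius a)).
  { destruct (CV_radius_bounded a) as [Hub _].
    apply (Hub ((1 + r) / 2)).
    pose proof (ex_series_lim_0 _ (Hu _ Hr')) as Hlim.
    destruct (filterlim_bounded (K := R_AbsRing) (V := R_NormedModule)
                (fun n => a n * ((1 + r) / 2) ^ n)) as [M HM].
    - exists 0; exact Hlim.
    - exists M; exact HM. }
  apply ex_series_ext with (fun n => Rabs (PS_derive a n * r ^ n)).
  - intros n; unfold PS_derive, deriv_coef.
    rewrite Cmod_mult, Cmod_R, (Rabs_pos_eq (INR (S n))) by apply pos_INR.
    apply Rabs_pos_eq; repeat apply Rmult_le_pos;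
      [apply pos_INR|apply Cmod_ge_0|apply pow_le; lra].
  - apply CV_disk_inside; rewrite CV_radius_derive.
    eapply Rbar_lt_le_trans; [|exact Hrad].
    simpl; rewrite Rabs_pos_eq; lra.
Qed.

Lemma CPSeries_unique (u : nat -> C) (z l : C) :
  csum (fun n => (z ^ n * u n)%C) l -> CPSeries u z = l.
Proof.
  intros H.
  apply (iota_unique (K := C_AbsRing) (V := C_CompleteNormedModule)).
  - intros y Hy; exact (csum_unique _ _ _ Hy H).
  - exact H.
Qed.

Lemma CPSeries_correct (u : nat -> C) (z : C) :
  unit_radius u -> Cmod z < 1 -> csum (fun n => (z ^ n * u n)%C) (CPSeries u z).
Proof.
  intros Hu Hz.
  assert (Hex : ex_series (K := C_AbsRing) (V := C_CompleteNormedModule)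
                  (fun n => (z ^ n * u n)%C)).
  { apply ex_series_le with (fun n => Cmod (u n) * Cmod z ^ n).
    - intros n; change (Cmod (z ^ n * u n) <= Cmod (u n) * Cmod z ^ n).
      rewrite Cmod_mult, Cmod_pow; lra.
    - apply Hu; split; [apply Cmod_ge_0|assumption]. }
  destruct Hex as [l Hl].
  now rewrite (CPSeries_unique u z l Hl).
Qed.

Lemma csum_comb (x y : C) (u v : nat -> C) (lu lv : C) :
  csum u lu -> csum v lv -> csum (fun n => (x * u n + y * v n)%C) (x * lu + y * lv)%C.
Proof.
  intros Hu Hv.
  apply (is_series_plus (K := C_AbsRing) (V := C_NormedModule));
  now apply (is_series_scal_l (K := C_AbsRing) (V := C_NormedModule)).
Qed.

Lemma csum_ext (u v : nat -> C) (l : C) : (forall n, u n = v n) -> csum u l -> csum v l.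
Proof. exact (is_series_ext (K := C_AbsRing) (V := C_NormedModule) u v l). Qed.

Lemma CPSeries_comb (x y : C) (u v : nat -> C) (z : C) :
  unit_radius u -> unit_radius v -> Cmod z < 1 ->
  CPSeries (fun n => (x * u n + y * v n)%C) z = (x * CPSeries u z + y * CPSeries v z)%C.
Proof.
  intros Hu Hv Hz; apply CPSeries_unique.
  apply csum_ext with (fun n => (x * (z ^ n * u n) + y * (z ^ n * v n))%C).
  - intros n; ring.
  - now apply csum_comb; apply CPSeries_correct.
Qed.

Lemma CPSeries_scal (x : C) (u : nat -> C) (z : C) :
  unit_radius u -> Cmod z < 1 ->
  CPSeries (fun n => (x * u n)%C) z = (x * CPSeries u z)%C.
Proof.
  intros Hu Hz; apply CPSeries_unique.
  apply csum_ext with (fun n => (x * (z ^ n * u n))%C).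
  - intros n; ring.
  - apply (is_series_scal_l (K := C_AbsRing) (V := C_NormedModule)).
    now apply CPSeries_correct.
Qed.

Lemma CPSeries_ext (u v : nat -> C) (z : C) :
  (forall n, u n = v n) -> unit_radius v -> Cmod z < 1 -> CPSeries u z = CPSeries v z.
Proof.
  intros H Hv Hz; apply CPSeries_unique.
  apply csum_ext with (fun n => (z ^ n * v n)%C).
  - intros n; now rewrite H.
  - now apply CPSeries_correct.
Qed.

Definition shift_coef (j : nat) (u : nat -> C) (n : nat) : C :=
  if Nat.ltb n j then 0%C else u (n - j)%nat.

Lemma csum_shift (j : nat) (u : nat -> C) (z : C) :
  unit_radius u -> Cmod z < 1 ->
  csum (fun n => (z ^ n * shift_coef j u n)%C) (z ^ j * CPSeries u z)%C.
Proof.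
  intros Hu Hz.
  eapply csum_ext.
  2: exact (is_pseries_incr_n (K := C_AbsRing) (V := C_NormedModule) u j z _
              (CPSeries_correct u z Hu Hz)).
  intros n; cbv beta; rewrite (PS_incr_n_simplify (K := C_AbsRing) (V := C_NormedModule)).
  change (z ^ n * (if Compare_dec.le_lt_dec j n then u (n - j)%nat else 0)
          = z ^ n * shift_coef j u n)%C.
  unfold shift_coef.
  destruct (Compare_dec.le_lt_dec j n), (Nat.ltb_spec n j); try lia; reflexivity.
Qed.

Lemma CPSeries_shift (j : nat) (u : nat -> C) (z : C) :
  unit_radius u -> Cmod z < 1 ->
  CPSeries (shift_coef j u) z = (z ^ j * CPSeries u z)%C.
Proof. intros Hu Hz; now apply CPSeries_unique, csum_shift. Qed.

(** A power series in [z ^ 2], evaluated through its coefficients in [z]: the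
    partial sum up to [N] on one side is the one up to [N / 2] on the other. *)
Lemma CPSeries_in_square (u : nat -> C) (z : C) :
  unit_radius u -> Cmod z < 1 -> CPSeries (in_square u) z = CPSeries u (z ^ 2).
Proof.
  intros Hu Hz; apply CPSeries_unique.
  assert (Hz2 : Cmod (z ^ 2) < 1).
  { rewrite Cmod_pow; pose proof (Cmod_ge_0 z); simpl; nra. }
  pose proof (CPSeries_correct u (z ^ 2) Hu Hz2) as H.
  assert (Hpartial : forall N, sum_n (G := C_AbelianMonoid) (fun n => (z ^ n * in_square u n)%C) N
    = sum_n (G := C_AbelianMonoid) (fun n => ((z ^ 2) ^ n * u n)%C) (Nat.div2 N)).
  { assert (Hboth : forall N,
      sum_n (G := C_AbelianMonoid) (fun n => (z ^ n * in_square u n)%C) (2 * N)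
      = sum_n (G := C_AbelianMonoid) (fun n => ((z ^ 2) ^ n * u n)%C) N /\
      sum_n (G := C_AbelianMonoid) (fun n => (z ^ n * in_square u n)%C) (S (2 * N))
      = sum_n (G := C_AbelianMonoid) (fun n => ((z ^ 2) ^ n * u n)%C) N).
    { assert (Hodd : forall N, in_square u (S (2 * N)) = 0%C).
      { intros N; unfold in_square.
        now rewrite Nat.even_succ, Nat.odd_mul. }
      assert (Heven : forall N, in_square u (2 * N) = u N).
      { intros N; unfold in_square.
        now rewrite Nat.even_mul, Nat.div2_double. }
      assert (Hstep : forall N,
        sum_n (G := C_AbelianMonoid) (fun n => (z ^ n * in_square u n)%C) (2 * N)
        = sum_n (G := C_AbelianMonoid) (fun n => ((z ^ 2) ^ n * u n)%C) N ->
        sum_n (G := C_AbelianMonoid) (fun n => (z ^ n * in_square u n)%C) (S (2 * N))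
        = sum_n (G := C_AbelianMonoid) (fun n => ((z ^ 2) ^ n * u n)%C) N).
      { intros N HN; rewrite sum_Sn, HN, Hodd.
        change (sum_n (G := C_AbelianMonoid) (fun n => ((z ^ 2) ^ n * u n)%C) N
                + z ^ S (2 * N) * 0
                = sum_n (G := C_AbelianMonoid) (fun n => ((z ^ 2) ^ n * u n)%C) N)%C.
        ring. }
      induction N as [|N [IH0 IH1]].
      - assert (H0 : sum_n (G := C_AbelianMonoid) (fun n => (z ^ n * in_square u n)%C) (2 * 0)
        = sum_n (G := C_AbelianMonoid) (fun n => ((z ^ 2) ^ n * u n)%C) 0).
        { simpl (2 * 0)%nat; rewrite !sum_O; reflexivity. }
        split; [exact H0|exact (Hstep _ H0)].
      - assert (H0 : sum_n (G := C_AbelianMonoid) (fun n => (z ^ n * in_square u n)%C) (2 * S N)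
        = sum_n (G := C_AbelianMonoid) (fun n => ((z ^ 2) ^ n * u n)%C) (S N)).
        { rewrite sum_Sn.
          replace (2 * S N)%nat with (S (S (2 * N))) by lia.
          rewrite sum_Sn, IH1.
          replace (S (S (2 * N))) with (2 * S N)%nat by lia.
          now rewrite Heven, Cpow_mult_r. }
        split; [exact H0|exact (Hstep _ H0)]. }
    intros N.
    destruct (Nat.Even_or_Odd N) as [[p ->]|[p ->]].
    - rewrite Nat.div2_double; apply Hboth.
    - rewrite Nat.add_1_r, Nat.div2_succ_double; apply Hboth. }
  apply (filterlim_ext (fun N => sum_n (G := C_AbelianMonoid)
                                   (fun n => ((z ^ 2) ^ n * u n)%C) (Nat.div2 N))).
  - intros N; symmetry; apply Hpartial.
  - eapply filterlim_comp; [|exact H].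
    intros P [N0 HN0]; exists (2 * N0)%nat; intros n Hn; apply HN0.
    apply Nat.div2_le_mono in Hn; now rewrite Nat.div2_double in Hn.
Qed.

(** For [n = 0] the meaningless exponent [pred 0] comes with the factor [0]. *)
Definition pow_remainder (z h : C) (n : nat) : C :=
  ((z + h) ^ n - z ^ n - INR n * h * z ^ pred n)%C.

(** The recursion
    [R (n + 1) = (z + h) * R n + n h^2 z^(n - 1)]
    is what makes the remainder quadratic in [h]. *)
Lemma pow_remainder_bound (z h : C) (r : R) (n : nat) :
  Cmod z <= r -> Cmod (z + h) <= r ->
  Cmod (pow_remainder z h (S (S n))) <= INR (S n) * INR (S (S n)) * r ^ n * Cmod h ^ 2.
Proof.
  intros Hz Hzh.
  assert (Hr : 0 <= r) by (pose proof (Cmod_ge_0 z); lra).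
  assert (Hrec : forall m, pow_remainder z h (S (S m))
    = ((z + h) * pow_remainder z h (S m) + INR (S m) * (h * h) * z ^ m)%C).
  { intros m; unfold pow_remainder.
    simpl pred; rewrite (S_INR (S m)), RtoC_plus, !Cpow_S.
    generalize ((z + h) ^ m)%C (z ^ m)%C (RtoC (INR (S m))); intros; ring. }
  induction n as [|n IH].
  - rewrite Hrec.
    replace (pow_remainder z h 1) with (RtoC 0) by (unfold pow_remainder; simpl; ring).
    rewrite Cmult_0_r, Cplus_0_l, !Cmod_mult, !Cmod_pow, Cmod_R.
    simpl INR; rewrite Rabs_R1; simpl pow.
    pose proof (pow2_ge_0 (Cmod h)); simpl pow in *; lra.
  - rewrite Hrec.
    eapply Rle_trans; [apply Cmod_triangle|].
    rewrite !Cmod_mult, !Cmod_pow, Cmod_R, (Rabs_pos_eq (INR _)) by apply pos_INR.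
    replace (Cmod h * Cmod h) with (Cmod h ^ 2) by ring.
    apply Rle_trans with (r * (INR (S n) * INR (S (S n)) * r ^ n * Cmod h ^ 2)
                          + INR (S (S n)) * Cmod h ^ 2 * r ^ S n).
    + apply Rplus_le_compat.
      * apply Rmult_le_compat; auto using Cmod_ge_0.
      * apply Rmult_le_compat_l.
        -- apply Rmult_le_pos; [apply pos_INR|apply pow2_ge_0].
        -- apply pow_incr; split; [apply Cmod_ge_0|assumption].
    + assert (0 <= r ^ n * Cmod h ^ 2)
        by (apply Rmult_le_pos; [apply pow_le|apply pow2_ge_0]; assumption).
      assert (0 <= r * (r ^ n * Cmod h ^ 2)) by (apply Rmult_le_pos; assumption).
      replace (r ^ S n) with (r * r ^ n) by reflexivity.
      pose proof (pos_INR n).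
      rewrite (S_INR (S (S n))), (S_INR (S n)), (S_INR n); nra.
Qed.

(** The coefficients times the remainders of the monomials sum to the remainder
    of the series, so a power series is complex differentiable term by term,
    with a quadratic error that is uniform on smaller disks. *)
Lemma CPSeries_quadratic_remainder (u : nat -> C) (r : R) :
  unit_radius u -> 0 <= r < 1 ->
  exists K, forall z h, Cmod z <= r -> Cmod (z + h) <= r ->
    Cmod (CPSeries u (z + h) - CPSeries u z - h * CPSeries (deriv_coef u) z)
    <= K * Cmod h ^ 2.
Proof.
  intros Hu Hr.
  pose proof (unit_radius_deriv _ (unit_radius_deriv _ Hu)) as Hu2.
  destruct (Hu2 r Hr) as [K HK].
  exists K; intros z h Hz Hzh.
  assert (Hlin : csum (fun n => (INR n * z ^ pred n * u n)%C) (CPSeries (deriv_coef u) z)).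
  { apply (is_series_decr_1 (K := C_AbsRing) (V := C_NormedModule)).
    match goal with |- is_series _ ?l => replace l with (CPSeries (deriv_coef u) z) end.
    2: { change (CPSeries (deriv_coef u) z
                 = CPSeries (deriv_coef u) z + - (INR 0 * z ^ pred 0 * u 0%nat))%C.
         simpl; ring. }
    apply csum_ext with (fun n => (z ^ n * deriv_coef u n)%C).
    - intros n; unfold deriv_coef; rewrite Nat.pred_succ; ring.
    - apply CPSeries_correct; [now apply unit_radius_deriv|lra]. }
  assert (Hrem : csum (fun n => (pow_remainder z h n * u n)%C)
            (CPSeries u (z + h) - CPSeries u z - h * CPSeries (deriv_coef u) z)%C).
  { pose proof (CPSeries_correct u (z + h) Hu ltac:(lra)) as H1.
    pose proof (CPSeries_correct u z Hu ltac:(lra)) as H2.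
    pose proof (csum_comb 1 (- (1)) _ _ _ _ H1 H2) as H3.
    pose proof (csum_comb 1 (- h) _ _ _ _ H3 Hlin) as H4.
    match type of H4 with csum _ ?l =>
      replace (CPSeries u (z + h) - CPSeries u z - h * CPSeries (deriv_coef u) z)%C
        with l by ring end.
    eapply csum_ext; [|exact H4].
    intros n; unfold pow_remainder; simpl; ring. }
  apply csum_norm_le with (u := fun n => (pow_remainder z h (2 + n) * u (2 + n)%nat)%C)
    (v := fun n => Cmod h ^ 2 * (Cmod (deriv_coef (deriv_coef u) n) * r ^ n)).
  - intros n; rewrite Cmod_mult.
    unfold deriv_coef; rewrite !Cmod_mult, !Cmod_R, !(Rabs_pos_eq (INR _)) by apply pos_INR.
    pose proof (pow_remainder_bound z h r n Hz Hzh) as Hb.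
    pose proof (Cmod_ge_0 (u (S (S n)))) as Hp.
    simpl plus.
    replace (Cmod h ^ 2 * (INR (S n) * (INR (S (S n)) * Cmod (u (S (S n)))) * r ^ n))
      with ((INR (S n) * INR (S (S n)) * r ^ n * Cmod h ^ 2) * Cmod (u (S (S n)))) by ring.
    now apply Rmult_le_compat_r.
  - apply (is_series_incr_n (K := C_AbsRing) (V := C_NormedModule)
             (fun n => (pow_remainder z h n * u n)%C) 2); [lia|].
    match goal with |- is_series _ ?l =>
      replace l with (CPSeries u (z + h) - CPSeries u z - h * CPSeries (deriv_coef u) z)%C
    end; [exact Hrem|].
    simpl pred; rewrite sum_Sn, sum_O.
    match goal with |- ?A = plus ?B (plus ?D ?E) => change (A = B + (D + E))%C end.
    unfold pow_remainder; simpl; ring.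
  - replace (K * Cmod h ^ 2) with (Cmod h ^ 2 * K) by apply Rmult_comm.
    apply (is_series_scal_l (K := R_AbsRing) (V := R_NormedModule) (Cmod h ^ 2)) in HK.
    exact HK.
Qed.

(** * Real parts of power series are smooth *)

(** The additive constant is there for surfaces given up to a translation; it
    does not affect the coefficients of the derivatives. *)
Definition real_part_on_disk (g : C -> R) (u : nat -> C) : Prop :=
  exists c : R, forall z, unit_disk z -> g z = Re (CPSeries u z) + c.

Definition direction (i : Defs.var) : C := match i with vx => 1%C | vy => Ci end.

Lemma slice_direction (i : Defs.var) (g : C -> R) (z : C) (h : R) :
  slice i g z (coord i z + h) = g (z + h * direction i)%C.
Proof.
  destruct z as [x y], i; simpl; f_equal; unfold Cplus, Cmult; simpl; f_equal; ring.
Qed.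

Lemma slice_coord (i : Defs.var) (g : C -> R) (z : C) : slice i g z (coord i z) = g z.
Proof. now destruct z as [x y], i. Qed.

Lemma Cmod_direction (i : Defs.var) : Cmod (direction i) = 1.
Proof. destruct i; [apply Cmod_1|apply Cmod_Ci]. Qed.

Lemma quadratic_is_derive (f : R -> R) (x l K d : R) :
  0 < d -> (forall h, Rabs h < d -> Rabs (f (x + h) - f x - h * l) <= K * h ^ 2) ->
  is_derive f x l.
Proof.
  intros Hd Hq; apply is_derive_Reals; intros eps Heps.
  assert (Hd' : 0 < Rmin d (eps / (Rabs K + 1))).
  { apply Rmin_pos; [assumption|apply Rdiv_lt_0_compat; [assumption|]].
    pose proof (Rabs_pos K); lra. }
  exists (mkposreal _ Hd'); simpl; intros h Hh Hhd.
  assert (Hh1 : Rabs h < d) by (eapply Rlt_le_trans; [exact Hhd|apply Rmin_l]).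
  assert (Hh2 : Rabs h < eps / (Rabs K + 1)) by (eapply Rlt_le_trans; [exact Hhd|apply Rmin_r]).
  pose proof (Rabs_pos K) as HK0.
  pose proof (Rabs_pos_lt h Hh) as Hhp.
  replace ((f (x + h) - f x) / h - l) with ((f (x + h) - f x - h * l) / h) by (field; assumption).
  rewrite Rabs_div by assumption.
  apply Rle_lt_trans with (Rabs K * Rabs h).
  - apply Rle_div_l; [assumption|].
    eapply Rle_trans; [now apply Hq|].
    rewrite Rmult_assoc, <- Rabs_mult, (Rabs_pos_eq (h * h)) by nra.
    pose proof (Rle_abs K); simpl; nra.
  - apply Rlt_div_r in Hh2; lra.
Qed.

Lemma real_part_is_derive (g : C -> R) (u : nat -> C) (i : Defs.var) (z : C) :
  unit_radius u -> real_part_on_disk g u -> unit_disk z ->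
  is_derive (slice i g z) (coord i z) (Re (direction i * CPSeries (deriv_coef u) z)).
Proof.
  intros Hu [c Hg] Hz; unfold unit_disk in Hz.
  set (r := (1 + Cmod z) / 2).
  pose proof (Cmod_ge_0 z) as Hz0.
  destruct (CPSeries_quadratic_remainder u r Hu) as [K HK]; [unfold r; lra|].
  apply quadratic_is_derive with K ((1 - Cmod z) / 2); [lra|].
  intros h Hh.
  assert (Hmod : Cmod (h * direction i) = Rabs h)
    by (rewrite Cmod_mult, Cmod_R, Cmod_direction; ring).
  assert (Hzh : Cmod (z + h * direction i) <= r).
  { eapply Rle_trans; [apply Cmod_triangle|]; rewrite Hmod; unfold r; lra. }
  rewrite slice_direction, slice_coord, !Hg; unfold unit_disk; [|lra|unfold r in Hzh; lra].
  specialize (HK z (h * direction i)%C ltac:(unfold r; lra) Hzh).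
  rewrite Hmod, RPow_abs, Rabs_pos_eq in HK by apply pow2_ge_0.
  eapply Rle_trans; [|exact HK].
  eapply Rle_trans; [|apply re_le_Cmod].
  right; f_equal.
  destruct (CPSeries u (z + h * direction i)) as [a1 a2], (CPSeries u z) as [b1 b2],
    (CPSeries (deriv_coef u) z) as [d1 d2], (direction i) as [e1 e2]; simpl; ring.
Qed.

Lemma real_part_partial (g : C -> R) (u : nat -> C) (i : Defs.var) (z : C) :
  unit_radius u -> real_part_on_disk g u -> unit_disk z ->
  partial i g z = Re (direction i * CPSeries (deriv_coef u) z).
Proof. intros Hu Hg Hz; now apply is_derive_unique, real_part_is_derive. Qed.

Definition partial_coef (i : Defs.var) (u : nat -> C) (n : nat) : C :=
  (direction i * deriv_coef u n)%C.

Lemma unit_radius_partial (i : Defs.var) (u : nat -> C) :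
  unit_radius u -> unit_radius (partial_coef i u).
Proof. intros Hu; now apply unit_radius_scal, unit_radius_deriv. Qed.

(** Real parts of power series are closed under partial derivatives: this is
    what makes the induction over iterated derivatives go through. *)
Lemma real_part_partial_closed (g : C -> R) (u : nat -> C) (i : Defs.var) :
  unit_radius u -> real_part_on_disk g u ->
  real_part_on_disk (partial i g) (partial_coef i u).
Proof.
  intros Hu Hg; exists 0; intros z Hz.
  rewrite (real_part_partial g u) by assumption.
  unfold partial_coef; rewrite CPSeries_scal; [ring|now apply unit_radius_deriv|exact Hz].
Qed.

Lemma real_part_continuous (g : C -> R) (u : nat -> C) (z : C) :
  unit_radius u -> real_part_on_disk g u -> unit_disk z ->
  continuous (T := C_UniformSpace) g z.
Proof.
  intros Hu [c Hg] Hz; unfold unit_disk in Hz.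
  set (r := (1 + Cmod z) / 2).
  pose proof (Cmod_ge_0 z) as Hz0.
  destruct (CPSeries_quadratic_remainder u r Hu) as [K HK]; [unfold r; lra|].
  set (M := Cmod (CPSeries (deriv_coef u) z) + Rabs K).
  assert (HM : 0 <= M)
    by (unfold M; pose proof (Cmod_ge_0 (CPSeries (deriv_coef u) z)); pose proof (Rabs_pos K); lra).
  apply filterlim_locally; intros eps.
  pose proof (cond_pos eps) as Heps.
  assert (Hd : 0 < Rmin ((1 - Cmod z) / 4) (eps / (2 * (M + 1)))).
  { apply Rmin_pos; [lra|apply Rdiv_lt_0_compat; lra]. }
  exists (mkposreal _ Hd); intros w Hw.
  apply C_NormedModule_mixin_compat2 in Hw; simpl in Hw.
  set (h := (w - z)%C).
  change (Cmod h < sqrt 2 * Rmin ((1 - Cmod z) / 4) (eps / (2 * (M + 1)))) in Hw.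
  assert (Hsqrt : sqrt 2 < 2).
  { rewrite <- (sqrt_square 2) at 2 by lra; apply sqrt_lt_1; lra. }
  pose proof (Cmod_ge_0 h) as Hh0.
  pose proof (Rmin_l ((1 - Cmod z) / 4) (eps / (2 * (M + 1)))) as Hmin1.
  pose proof (Rmin_r ((1 - Cmod z) / 4) (eps / (2 * (M + 1)))) as Hmin2.
  assert (Hh1 : Cmod h < (1 - Cmod z) / 2) by nra.
  assert (Hh2 : Cmod h < eps / (M + 1)).
  { replace (eps / (M + 1)) with (2 * (eps / (2 * (M + 1)))) by (field; lra).
    assert (0 < eps / (2 * (M + 1))) by (apply Rdiv_lt_0_compat; lra); nra. }
  assert (Hcancel : forall p q : C, p = (q + (p - q))%C) by (intros; ring).
  assert (Hw_eq : w = (z + h)%C) by exact (Hcancel w z).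
  assert (Hzh : Cmod (z + h) <= r).
  { eapply Rle_trans; [apply Cmod_triangle|]; unfold r; lra. }
  specialize (HK z h ltac:(unfold r; lra) Hzh).
  change (Rabs (g w - g z) < eps).
  rewrite Hw_eq, !Hg; unfold unit_disk; [|lra|unfold r in Hzh; lra].
  apply Rle_lt_trans with (Cmod h * M).
  - apply Rle_trans with (Cmod (CPSeries u (z + h) - CPSeries u z)).
    + eapply Rle_trans; [|apply re_le_Cmod].
      right; f_equal.
      change (Re (CPSeries u (z + h)) + c - (Re (CPSeries u z) + c)
              = Re (CPSeries u (z + h)) + - Re (CPSeries u z)); ring.
    + replace (CPSeries u (z + h) - CPSeries u z)%C
        with ((CPSeries u (z + h) - CPSeries u z - h * CPSeries (deriv_coef u) z)
              + h * CPSeries (deriv_coef u) z)%C by ring.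
      eapply Rle_trans; [apply Cmod_triangle|].
      rewrite Cmod_mult; unfold M.
      pose proof (Rle_abs K); pose proof (Rabs_pos K).
      assert (K * Cmod h ^ 2 <= Rabs K * Cmod h).
      { simpl; assert (Cmod h * Cmod h <= Cmod h) by nra.
        assert (0 <= Cmod h * Cmod h) by nra.
        rewrite Rmult_1_r; nra. }
      lra.
  - apply Rlt_div_r in Hh2; lra.
Qed.

Lemma real_part_smooth (g : C -> R) (u : nat -> C) :
  unit_radius u -> real_part_on_disk g u -> smooth_on unit_disk g.
Proof.
  intros Hu Hg w z Hz h.
  assert (Hh : exists v, unit_radius v /\ real_part_on_disk h v).
  { unfold h; clear h; induction w as [|i w (v & Hv & Hw)].
    - now exists u.
    - exists (partial_coef i v); split.
      + now apply unit_radius_partial.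
      + now apply real_part_partial_closed. }
  destruct Hh as (v & Hv & Hhv); split.
  - exact (real_part_continuous h v z Hv Hhv Hz).
  - intros i; eexists; exact (real_part_is_derive h v i z Hv Hhv Hz).
Qed.

(** * Weierstrass data *)

(** A surface whose coordinates are the real parts of power series with
    derivatives [phi1], [phi2], [phi3] such that
    [phi1 ^ 2 + phi2 ^ 2 + phi3 ^ 2 = 0].  This isotropy says that the parameter
    [z] is conformal, so [E = G] and [F = 0]; harmonicity of the coordinates
    gives [X_xx + X_yy = 0], and so the numerator [E n - 2 F m + G l] of the
    mean curvature vanishes.  The normal has squared length [E G - F ^ 2 = E ^ 2],
    so it can only vanish where all the [phi]s do. *)
Lemma isotropic_minimal_surface (X : C -> R3) (u1 u2 u3 : nat -> C) :
  unit_radius u1 -> unit_radius u2 -> unit_radius u3 ->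
  real_part_on_disk (fun z => p1 (X z)) u1 ->
  real_part_on_disk (fun z => p2 (X z)) u2 ->
  real_part_on_disk (fun z => p3 (X z)) u3 ->
  (forall z, unit_disk z ->
    (CPSeries (deriv_coef u1) z ^ 2 + CPSeries (deriv_coef u2) z ^ 2
     + CPSeries (deriv_coef u3) z ^ 2 = 0)%C) ->
  (forall z, unit_disk z ->
    CPSeries (deriv_coef u1) z <> 0%C \/ CPSeries (deriv_coef u2) z <> 0%C
    \/ CPSeries (deriv_coef u3) z <> 0%C) ->
  minimal_surface unit_disk X.
Proof.
  intros Hu1 Hu2 Hu3 H1 H2 H3 Hiso Hne.
  assert (Hfirst : forall i z, unit_disk z -> partial3 i X z =
    (Re (direction i * CPSeries (deriv_coef u1) z),
     Re (direction i * CPSeries (deriv_coef u2) z),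
     Re (direction i * CPSeries (deriv_coef u3) z))).
  { intros i z Hz; unfold partial3.
    now rewrite (real_part_partial _ _ i z Hu1 H1 Hz), (real_part_partial _ _ i z Hu2 H2 Hz),
      (real_part_partial _ _ i z Hu3 H3 Hz). }
  assert (Hconf : forall z, unit_disk z ->
    fund1 X vx vx z = fund1 X vy vy z /\ fund1 X vx vy z = 0).
  { intros z Hz; specialize (Hiso z Hz).
    unfold fund1; rewrite !Hfirst by assumption; unfold dot, p1, p2, p3.
    destruct (CPSeries (deriv_coef u1) z) as [a1 b1], (CPSeries (deriv_coef u2) z) as [a2 b2],
      (CPSeries (deriv_coef u3) z) as [a3 b3].
    simpl in Hiso |- *; injection Hiso as Hre Him; split; lra. }
  split.
  - split; [|split; [|split]].
    + exact (real_part_smooth _ u1 Hu1 H1).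
    + exact (real_part_smooth _ u2 Hu2 H2).
    + exact (real_part_smooth _ u3 Hu3 H3).
    + intros z Hz Hnormal.
      destruct (Hconf z Hz) as [HEG HF].
      unfold fund1, normal in HEG, HF, Hnormal; rewrite !Hfirst in HEG, HF, Hnormal by assumption;
        unfold dot, cross, p1, p2, p3 in HEG, HF, Hnormal.
      specialize (Hne z Hz).
      destruct (CPSeries (deriv_coef u1) z) as [a1 b1], (CPSeries (deriv_coef u2) z) as [a2 b2],
        (CPSeries (deriv_coef u3) z) as [a3 b3].
      simpl in HEG, HF, Hnormal; injection Hnormal as Hn1 Hn2 Hn3.
      set (E := a1 * a1 + a2 * a2 + a3 * a3).
      assert (HE : E * E = 0).
      { (* Lagrange's identity [E G - F^2 = |normal|^2] *)
        assert (HG : b1 * b1 + b2 * b2 + b3 * b3 = E) by (unfold E; lra).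
        assert (HF' : a1 * b1 + a2 * b2 + a3 * b3 = 0) by lra.
        rewrite <- HG at 2; unfold E.
        replace ((a1 * a1 + a2 * a2 + a3 * a3) * (b1 * b1 + b2 * b2 + b3 * b3))
          with ((a1 * b1 + a2 * b2 + a3 * b3) * (a1 * b1 + a2 * b2 + a3 * b3)
            + (a2 * b3 - a3 * b2) * (a2 * b3 - a3 * b2)
            + (a3 * b1 - a1 * b3) * (a3 * b1 - a1 * b3)
            + (a1 * b2 - a2 * b1) * (a1 * b2 - a2 * b1)) by ring.
        replace (a2 * b3 - a3 * b2) with 0 by lra.
        replace (a3 * b1 - a1 * b3) with 0 by lra.
        replace (a1 * b2 - a2 * b1) with 0 by lra.
        rewrite HF'; ring. }
      assert (HE0 : a1 * a1 + a2 * a2 + a3 * a3 = 0) by (unfold E in *; nra).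
      assert (HG0 : b1 * b1 + b2 * b2 + b3 * b3 = 0) by lra.
      assert (a1 = 0 /\ a2 = 0 /\ a3 = 0) as (-> & -> & ->) by (repeat split; nra).
      assert (b1 = 0 /\ b2 = 0 /\ b3 = 0) as (-> & -> & ->) by (repeat split; nra).
      now destruct Hne as [H|[H|H]].
  - intros z Hz; unfold mean_curvature.
    destruct (Hconf z Hz) as [HEG HF].
    assert (Hsecond : forall i g u, unit_radius u -> real_part_on_disk g u ->
      partial i (partial i g) z
      = Re (direction i * direction i * CPSeries (deriv_coef (deriv_coef u)) z)).
    { intros i g u Hu Hg.
      rewrite (real_part_partial _ (partial_coef i u) i z (unit_radius_partial i u Hu)
                 (real_part_partial_closed g u i Hu Hg) Hz).
      assert (Hu' := unit_radius_deriv _ (unit_radius_deriv _ Hu)).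
      rewrite (CPSeries_ext (deriv_coef (partial_coef i u))
                 (fun n => (direction i * deriv_coef (deriv_coef u) n)%C)).
      - now rewrite CPSeries_scal, Cmult_assoc.
      - intros n; unfold deriv_coef, partial_coef, deriv_coef; ring.
      - now apply unit_radius_scal.
      - exact Hz. }
    assert (Hharm : fund2 X vy vy z = - fund2 X vx vx z).
    { unfold fund2, dot.
      assert (Hopp : forall g u, unit_radius u -> real_part_on_disk g u ->
        partial vy (partial vy g) z = - partial vx (partial vx g) z).
      { intros g u Hu Hg; rewrite !(Hsecond _ g u Hu Hg).
        destruct (CPSeries (deriv_coef (deriv_coef u)) z) as [a b]; simpl; ring. }
      set (N := unit_normal X z).
      change (partial vy (partial vy (fun w => p1 (X w))) z * p1 N
              + partial vy (partial vy (fun w => p2 (X w))) z * p2 N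
              + partial vy (partial vy (fun w => p3 (X w))) z * p3 N
              = - (partial vx (partial vx (fun w => p1 (X w))) z * p1 N
              + partial vx (partial vx (fun w => p2 (X w))) z * p2 N
              + partial vx (partial vx (fun w => p3 (X w))) z * p3 N)).
      rewrite (Hopp _ u1 Hu1 H1), (Hopp _ u2 Hu2 H2), (Hopp _ u3 Hu3 H3).
      ring. }
    rewrite HEG, HF, Hharm.
    match goal with |- ?N / _ = 0 => replace N with 0 by ring end.
    unfold Rdiv; ring.
Qed.

(** * Improper integrals over the positive half-line *)

Definition is_improper (f : R -> R) (l : R) : Prop :=
  is_RInt_gen (V := R_NormedModule) f (at_right 0) (Rbar_locally p_infty) l.

Lemma eventually_positive_interval (P : R * R -> Prop) :
  (forall a b, 0 < a -> a <= b -> P (a, b)) ->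
  filter_prod (at_right 0) (Rbar_locally p_infty) P.
Proof.
  intros H.
  exists (fun a => 0 < a < 1) (fun b => 1 < b).
  - exists (mkposreal 1 Rlt_0_1); intros a Ha Ha0.
    change (Rabs (a - 0) < 1) in Ha; rewrite Rabs_pos_eq in Ha; lra.
  - exists 1; intros b Hb; exact Hb.
  - intros a b Ha Hb; apply H; lra.
Qed.

Lemma at_right_0_positive : at_right 0 (fun t => 0 < t).
Proof. exists (mkposreal 1 Rlt_0_1); intros t _ Ht; exact Ht. Qed.

Lemma is_improper_ext (f g : R -> R) (l : R) :
  (forall t, 0 < t -> f t = g t) -> is_improper f l -> is_improper g l.
Proof.
  intros H.
  apply (is_RInt_gen_ext (V := R_NormedModule) (Fa := at_right 0)
           (Fb := Rbar_locally p_infty) f g l).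
  apply eventually_positive_interval; intros a b Ha Hab t Ht; simpl in Ht.
  rewrite Rmin_left in Ht by lra; apply H; lra.
Qed.

Lemma is_improper_comb (x y : R) (f g : R -> R) (lf lg : R) :
  is_improper f lf -> is_improper g lg ->
  is_improper (fun t => x * f t + y * g t) (x * lf + y * lg).
Proof.
  intros Hf Hg.
  apply (is_RInt_gen_plus (V := R_NormedModule) (fun t => x * f t) (fun t => y * g t));
  now apply (is_RInt_gen_scal (V := R_NormedModule)).
Qed.

Lemma is_improper_unique (f : R -> R) (l l' : R) :
  is_improper f l -> is_improper f l' -> l = l'.
Proof.
  intros H H'.
  rewrite <- (is_RInt_gen_unique (V := R_CompleteNormedModule) f l H).
  exact (is_RInt_gen_unique (V := R_CompleteNormedModule) f l' H').
Qed.

Lemma is_improper_ge_0 (f : R -> R) (l : R) :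
  (forall t, 0 < t -> 0 <= f t) -> is_improper f l -> 0 <= l.
Proof.
  intros H Hf.
  assert (H0 : is_improper (fun _ => 0) 0).
  { apply is_improper_ext with (fun t => 0 * f t + 0 * f t); [intros; ring|].
    pose proof (is_improper_comb 0 0 f f l l Hf Hf) as H0.
    now replace (0 * l + 0 * l) with 0 in H0 by ring. }
  apply Rle_trans with (norm 0); [apply norm_ge_0|].
  refine (RInt_gen_norm (V := R_CompleteNormedModule) (fun _ => 0) f 0 l _ _ H0 Hf).
  - now apply eventually_positive_interval.
  - apply eventually_positive_interval; intros a b Ha Hab t Ht; simpl in Ht.
    unfold norm; simpl; unfold abs; simpl; rewrite Rabs_R0; apply H; lra.
Qed.

Lemma is_improper_FTC (F f : R -> R) (l0 l1 : R) :
  (forall t, 0 < t -> is_derive F t (f t)) ->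
  (forall t, 0 < t -> continuous f t) ->
  filterlim F (at_right 0) (locally l0) ->
  filterlim F (Rbar_locally p_infty) (locally l1) ->
  is_improper f (l1 - l0).
Proof.
  intros HF Hf H0 H1.
  apply is_improper_ext with (Derive F).
  { intros t Ht; now apply is_derive_unique, HF. }
  apply (is_RInt_gen_Derive (Fa := at_right 0) (Fb := Rbar_locally p_infty) F l0 l1);
    [| |assumption|assumption].
  - apply eventually_positive_interval; intros a b Ha Hab t Ht; simpl in Ht.
    rewrite Rmin_left in Ht by lra; eexists; apply HF; lra.
  - apply eventually_positive_interval; intros a b Ha Hab t Ht; simpl in Ht.
    rewrite Rmin_left in Ht by lra.
    assert (Ht0 : 0 < t) by lra.
    apply continuous_ext_loc with f; [|now apply Hf].
    exists (mkposreal t Ht0); intros s Hs.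
    change (Rabs (s - t) < t) in Hs; apply Rabs_def2 in Hs.
    symmetry; apply is_derive_unique, HF; lra.
Qed.

(** Cauchy's criterion: increments controlled by those of a convergent
    function. *)
Lemma filterlim_controlled (Fl : (R -> Prop) -> Prop) {PF : ProperFilter Fl}
    (F G : R -> R) (l : R) :
  Fl (fun t => 0 < t) ->
  (forall s t, 0 < s -> 0 < t -> Rabs (F t - F s) <= Rabs (G t - G s)) ->
  filterlim G Fl (locally l) ->
  exists l', filterlim F Fl (locally l').
Proof.
  intros Hpos Hle HG.
  apply (filterlim_locally_cauchy (U := R_CompleteSpace) F); intros eps.
  destruct (proj2 (filterlim_locally_cauchy (U := R_CompleteSpace) G)
              (ex_intro _ l HG) eps) as (P & HP & HPG).
  exists (fun t => P t /\ 0 < t); split; [now apply filter_and|].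
  intros s t [Hs Hs0] [Ht Ht0].
  eapply Rle_lt_trans; [apply (Hle s t Hs0 Ht0)|exact (HPG s t Hs Ht)].
Qed.

(** Domination: the primitive of [f] from [1] has smaller increments than the
    primitive [G] of the majorant. *)
Lemma ex_improper_dominated (f g G : R -> R) (l0 l1 : R) :
  (forall t, 0 < t -> continuous f t) ->
  (forall t, 0 < t -> Rabs (f t) <= g t) ->
  (forall t, 0 < t -> is_derive G t (g t)) ->
  filterlim G (at_right 0) (locally l0) ->
  filterlim G (Rbar_locally p_infty) (locally l1) ->
  exists l, is_improper f l.
Proof.
  intros Hf Hle HG H0 H1.
  set (F := fun t => RInt f 1 t).
  assert (HF : forall t, 0 < t -> is_derive F t (f t)).
  { intros t Ht; apply (is_derive_RInt (V := R_NormedModule) f F 1 t); [|now apply Hf].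
    exists (mkposreal t Ht); intros s Hs.
    change (Rabs (s - t) < t) in Hs; apply Rabs_def2 in Hs.
    apply (RInt_correct (V := R_CompleteNormedModule)), ex_RInt_continuous.
    intros x Hx; apply Hf.
    pose proof (Rmin_glb_lt 1 s 0 ltac:(lra) ltac:(lra)); lra. }
  assert (Hmono : forall s t, 0 < s -> s <= t -> Rabs (F t - F s) <= G t - G s).
  { intros s t Hs Hst.
    assert (Hsign : forall e, e = 1 \/ e = -1 -> e * (F t - F s) <= G t - G s).
    { intros e He.
      assert (Hder : forall x, 0 < x -> is_derive (fun x => G x - e * F x) x (g x - e * f x)).
      { intros x Hx.
        apply (is_derive_minus (V := R_NormedModule) G (fun x => e * F x)); [now apply HG|].
        now apply (is_derive_scal F x e), HF. }
      destruct (MVT_gen (fun x => G x - e * F x) s t (fun x => g x - e * f x))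
        as (c & Hc & Heq).
      - intros x Hx; rewrite Rmin_left in Hx by lra; apply Hder; lra.
      - intros x Hx; rewrite Rmin_left in Hx by lra.
        apply continuity_pt_filterlim.
        apply (ex_derive_continuous (K := R_AbsRing) (V := R_NormedModule)
                 (fun x => G x - e * F x) x).
        eexists; apply Hder; lra.
      - rewrite Rmin_left, Rmax_right in Hc by lra.
        specialize (Hle c ltac:(lra)).
        assert (0 <= g c - e * f c).
        { pose proof (Rle_abs (f c)); pose proof (Rle_abs (- f c)) as Hm.
          rewrite Rabs_Ropp in Hm; destruct He as [-> | ->]; lra. }
        assert (0 <= (g c - e * f c) * (t - s)) by (apply Rmult_le_pos; lra).
        simpl in Heq; lra. }
    pose proof (Hsign 1 (or_introl eq_refl)); pose proof (Hsign (-1) (or_intror eq_refl)).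
    apply Rabs_le; lra. }
  assert (Hctrl : forall s t, 0 < s -> 0 < t -> Rabs (F t - F s) <= Rabs (G t - G s)).
  { intros s t Hs Ht; destruct (Rle_or_lt s t) as [H|H].
    - eapply Rle_trans; [now apply Hmono|apply Rle_abs].
    - rewrite (Rabs_minus_sym (F t)), (Rabs_minus_sym (G t)).
      eapply Rle_trans; [apply Hmono; lra|apply Rle_abs]. }
  destruct (filterlim_controlled (at_right 0) F G l0) as [m0 Hm0];
    [exact at_right_0_positive|exact Hctrl|exact H0|].
  destruct (filterlim_controlled (Rbar_locally p_infty) F G l1) as [m1 Hm1];
    [exists 0; now intros|exact Hctrl|exact H1|].
  exists (m1 - m0); now apply is_improper_FTC with F.
Qed.

(** * The Gamma function *)

Definition trig (c d tau t : R) : R := c * cos (tau * ln t) + d * sin (tau * ln t).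

(** The real and imaginary parts of Euler's integrand at [sigma + i tau] are the
    cases [(c, d) = (1, 0)] and [(0, 1)]; differentiation mixes the two, hence the
    general [c] and [d]. *)
Definition gamma_kernel (c d sigma tau t : R) : R :=
  exp (- t) * Rpower t (sigma - 1) * trig c d tau t.

Lemma trig_bound (c d tau t : R) : Rabs (trig c d tau t) <= Rabs c + Rabs d.
Proof.
  unfold trig; eapply Rle_trans; [apply Rabs_triang|].
  rewrite !Rabs_mult.
  assert (Hc : Rabs (cos (tau * ln t)) <= 1) by (apply Rabs_le, COS_bound).
  assert (Hs : Rabs (sin (tau * ln t)) <= 1) by (apply Rabs_le, SIN_bound).
  pose proof (Rabs_pos c); pose proof (Rabs_pos d); nra.
Qed.

Lemma exp_monotone (x y : R) : x <= y -> exp x <= exp y.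
Proof. intros [H| ->]; [left; now apply exp_increasing|right; reflexivity]. Qed.

(** The maximum over [t > -1] of [exp (- t) * (1 + t) ^ p], attained at
    [1 + t = p]. *)
Definition exp_decay_bound (p : R) : R := exp (1 - p + p * ln p).

Lemma exp_decay (p t : R) : 0 < p -> 0 <= t ->
  exp (- t) <= exp_decay_bound p * Rpower (1 + t) (- p).
Proof.
  intros Hp Ht; unfold exp_decay_bound, Rpower; rewrite <- exp_plus.
  assert (Hln : ln ((1 + t) / p) <= (1 + t) / p - 1).
  { assert (H : 0 < (1 + t) / p) by (apply Rdiv_lt_0_compat; lra).
    pose proof (exp_ineq1_le (ln ((1 + t) / p))) as H1; rewrite exp_ln in H1; lra. }
  rewrite ln_div in Hln by lra.
  assert (Hm : p * (ln (1 + t) - ln p) <= p * ((1 + t) / p - 1))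
    by (apply Rmult_le_compat_l; lra).
  replace (p * ((1 + t) / p - 1)) with (1 + t - p) in Hm by (field; lra).
  apply exp_monotone; lra.
Qed.

Lemma Rpower_at_0 (s : R) : 0 < s ->
  filterlim (fun t => Rpower t s) (at_right 0) (locally 0).
Proof.
  intros Hs; unfold Rpower.
  apply (filterlim_comp _ _ _ (fun t => s * ln t) exp (at_right 0) (Rbar_locally m_infty)).
  - apply (filterlim_comp _ _ _ ln (fun y => s * y) (at_right 0) (Rbar_locally m_infty)).
    + exact is_lim_ln_0.
    + intros P [M HM]; exists (M / s); intros y Hy; apply HM.
      apply Rlt_div_r in Hy; lra.
  - exact is_lim_exp_m.
Qed.

(** The substitution [u = t / (1 + t)] maps the half-line to the unit interval,
    and the derivative of [u ^ s / s] is [t ^ (s - 1) (1 + t) ^ (- s - 1)], which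
    up to a constant factor dominates Euler's integrand. *)
Definition majorant_primitive (s t : R) : R :=
  exp_decay_bound (s + 1) / s * Rpower (t / (1 + t)) s.

Lemma majorant_primitive_derive (s t : R) : 0 < s -> 0 < t ->
  is_derive (majorant_primitive s) t
    (exp_decay_bound (s + 1) * Rpower (1 + t) (- (s + 1))
     * Rpower t (s - 1)).
Proof.
  intros Hs Ht; unfold majorant_primitive, Rpower.
  set (M := exp_decay_bound (s + 1)); auto_derive.
  - repeat split; try lra; apply Rdiv_lt_0_compat; lra.
  - replace (ln (t * / (1 + t))) with (ln t - ln (1 + t))
      by (symmetry; apply ln_div; lra).
    replace (s * (ln t - ln (1 + t)))
      with ((- (s + 1)) * ln (1 + t) + (s - 1) * ln t + ln t + ln (1 + t)) by ring.
    rewrite !exp_plus, !exp_ln by lra.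
    field; lra.
Qed.

Lemma majorant_primitive_at_0 (s : R) : 0 < s ->
  filterlim (majorant_primitive s) (at_right 0) (locally 0).
Proof.
  intros Hs; unfold majorant_primitive.
  set (M := exp_decay_bound (s + 1) / s).
  replace (locally 0) with (locally (M * 0)) by (f_equal; ring).
  apply (filterlim_comp _ _ _ (fun t => Rpower (t / (1 + t)) s) (fun y => M * y)
           (at_right 0) (locally 0)).
  - apply (filterlim_le_le (fun _ => 0) _ (fun t => Rpower t s) (Finite 0)).
    + apply filter_imp with (2 := at_right_0_positive); intros t Ht; split.
      * unfold Rpower; left; apply exp_pos.
      * apply Rle_Rpower_l; [lra|]; split; [apply Rdiv_lt_0_compat; lra|].
        apply Rle_div_l; nra.
    + apply filterlim_const.
    + now apply Rpower_at_0.
  - apply (filterlim_scal_r (K := R_AbsRing) (V := R_NormedModule) M 0).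
Qed.

Lemma majorant_primitive_at_infty (s : R) : 0 < s ->
  exists l, filterlim (majorant_primitive s) (Rbar_locally p_infty) (locally l).
Proof.
  intros Hs; unfold majorant_primitive.
  set (M := exp_decay_bound (s + 1) / s).
  exists (M * Rpower 1 s).
  assert (Hlim : is_lim (fun t => 1 - / (1 + t)) p_infty 1).
  { replace (Finite 1) with (Finite (1 - 0)) by (f_equal; ring).
    apply is_lim_minus'; [apply is_lim_const|].
    replace (Finite 0) with (Rbar_inv p_infty) by reflexivity.
    apply is_lim_inv; [|discriminate].
    apply is_lim_plus with 1 p_infty; [apply is_lim_const|apply is_lim_id|reflexivity]. }
  apply (filterlim_comp _ _ _ (fun t => t / (1 + t)) (fun u => M * Rpower u s)
    (Rbar_locally p_infty) (locally 1)).
  - apply filterlim_ext_loc with (2 := Hlim).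
    exists 0; intros t Ht; field; lra.
  - apply (ex_derive_continuous (K := R_AbsRing) (V := R_NormedModule)
             (fun u => M * Rpower u s)).
    unfold Rpower; auto_derive; lra.
Qed.

Lemma gamma_kernel_continuous (c d sigma tau t : R) :
  0 < t -> continuous (gamma_kernel c d sigma tau) t.
Proof.
  intros Ht; apply (ex_derive_continuous (K := R_AbsRing) (V := R_NormedModule)).
  unfold gamma_kernel, trig, Rpower; auto_derive; repeat split; lra.
Qed.

Lemma gamma_kernel_integrable (c d sigma tau : R) :
  0 < sigma -> exists l, is_improper (gamma_kernel c d sigma tau) l.
Proof.
  intros Hs.
  set (K := Rabs c + Rabs d).
  destruct (majorant_primitive_at_infty sigma Hs) as [l1 Hl1].
  apply (ex_improper_dominated (gamma_kernel c d sigma tau)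
    (fun t => K * (exp_decay_bound (sigma + 1) * Rpower (1 + t) (- (sigma + 1))
                   * Rpower t (sigma - 1)))
    (fun t => K * majorant_primitive sigma t) (K * 0) (K * l1)).
  - intros t Ht; now apply gamma_kernel_continuous.
  - intros t Ht; unfold gamma_kernel.
    rewrite Rabs_mult, Rmult_comm.
    assert (Hp : 0 < Rpower t (sigma - 1)) by apply exp_pos.
    pose proof (exp_decay (sigma + 1) t ltac:(lra) ltac:(lra)) as Hd.
    pose proof (exp_pos (- t)) as He.
    rewrite (Rabs_pos_eq (exp (- t) * _)) by nra.
    apply Rmult_le_compat; [apply Rabs_pos|nra|apply trig_bound|].
    apply Rmult_le_compat_r; lra.
  - intros t Ht; apply is_derive_scal.
    now apply majorant_primitive_derive.
  - eapply filterlim_comp; [now apply majorant_primitive_at_0|].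
    apply (filterlim_scal_r (K := R_AbsRing) (V := R_NormedModule) K 0).
  - eapply filterlim_comp; [exact Hl1|].
    apply (filterlim_scal_r (K := R_AbsRing) (V := R_NormedModule) K l1).
Qed.

Definition gamma_int (c d sigma tau : R) : R :=
  RInt_gen (V := R_CompleteNormedModule) (gamma_kernel c d sigma tau)
    (at_right 0) (Rbar_locally p_infty).

Lemma gamma_int_correct (c d sigma tau : R) :
  0 < sigma -> is_improper (gamma_kernel c d sigma tau) (gamma_int c d sigma tau).
Proof.
  intros Hs.
  apply (RInt_gen_correct (V := R_CompleteNormedModule) (Fa := at_right 0)
           (Fb := Rbar_locally p_infty) (gamma_kernel c d sigma tau)).
  now apply gamma_kernel_integrable.
Qed.

Lemma gamma_int_unique (c d sigma tau l : R) :
  is_improper (gamma_kernel c d sigma tau) l -> gamma_int c d sigma tau = l.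
Proof. exact (is_RInt_gen_unique (V := R_CompleteNormedModule) _ l). Qed.

Lemma gamma_int_linear (c d sigma tau : R) : 0 < sigma ->
  gamma_int c d sigma tau = c * gamma_int 1 0 sigma tau + d * gamma_int 0 1 sigma tau.
Proof.
  intros Hs; apply gamma_int_unique.
  apply is_improper_ext with
    (fun t => c * gamma_kernel 1 0 sigma tau t + d * gamma_kernel 0 1 sigma tau t).
  - intros t _; unfold gamma_kernel, trig; ring.
  - now apply is_improper_comb; apply gamma_int_correct.
Qed.

(** Integration by parts; [exp (- t) * t ^ sigma] vanishes at both ends. *)
Lemma gamma_int_succ (c d sigma tau : R) : 0 < sigma ->
  gamma_int c d (sigma + 1) tau
  = gamma_int (sigma * c + tau * d) (sigma * d - tau * c) sigma tau.
Proof.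
  intros Hs.
  set (c' := sigma * c + tau * d); set (d' := sigma * d - tau * c).
  set (K := Rabs c + Rabs d).
  assert (HK : 0 <= K) by (unfold K; pose proof (Rabs_pos c); pose proof (Rabs_pos d); lra).
  assert (Hparts : is_improper
    (fun t => 1 * gamma_kernel c' d' sigma tau t + -1 * gamma_kernel c d (sigma + 1) tau t)
    (0 - 0)).
  { apply is_improper_FTC with (gamma_kernel c d (sigma + 1) tau).
    - intros t Ht; unfold gamma_kernel, trig, Rpower; auto_derive; [repeat split; lra|].
      replace ((sigma + 1 + -1) * ln t) with ((sigma - 1) * ln t + ln t) by ring.
      replace ((sigma + 1 - 1) * ln t) with ((sigma - 1) * ln t + ln t) by ring.
      rewrite !exp_plus, !exp_ln by lra.
      unfold c', d'; field; lra.
    - intros t Ht; apply (ex_derive_continuous (K := R_AbsRing) (V := R_NormedModule)).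
      unfold gamma_kernel, trig, Rpower; auto_derive; repeat split; lra.
    - apply (filterlim_norm_zero (K := R_AbsRing) (V := R_NormedModule)).
      apply (filterlim_le_le (fun _ => 0) _ (fun t => K * Rpower t sigma) (Finite 0)).
      + apply filter_imp with (2 := at_right_0_positive); intros t Ht; split;
          [apply norm_ge_0|].
        unfold norm; simpl; unfold abs; simpl; unfold gamma_kernel.
        replace (sigma + 1 - 1) with sigma by ring.
        assert (Hp : 0 < Rpower t sigma) by apply exp_pos.
        pose proof (exp_pos (- t)) as He.
        assert (He1 : exp (- t) <= 1) by (rewrite <- exp_0; apply exp_monotone; lra).
        rewrite Rabs_mult, Rmult_comm, (Rabs_pos_eq (exp (- t) * _)) by nra.
        apply Rmult_le_compat; [apply Rabs_pos|nra|apply trig_bound|nra].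
      + apply filterlim_const.
      + replace (Rbar_locally (Finite 0)) with (Rbar_locally (Finite (K * 0)))
          by (do 2 f_equal; ring).
        eapply filterlim_comp; [now apply Rpower_at_0|].
        apply (filterlim_scal_r (K := R_AbsRing) (V := R_NormedModule) K 0).
    - apply (filterlim_norm_zero (K := R_AbsRing) (V := R_NormedModule)).
      apply (filterlim_le_le (fun _ => 0) _
               (fun t => (K * exp_decay_bound (sigma + 1)) * / (1 + t)) (Finite 0)).
      + exists 0; intros t Ht; split; [apply norm_ge_0|].
        unfold norm; simpl; unfold abs; simpl; unfold gamma_kernel.
        replace (sigma + 1 - 1) with sigma by ring.
        assert (Hp : 0 < Rpower t sigma) by apply exp_pos.
        pose proof (exp_pos (- t)) as He.
        assert (Hd : exp (- t) * Rpower t sigma <= exp_decay_bound (sigma + 1) * / (1 + t)).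
        { replace (/ (1 + t)) with (Rpower (1 + t) (- (sigma + 1)) * Rpower (1 + t) sigma).
          - rewrite <- Rmult_assoc; apply Rmult_le_compat; [lra|lra| |].
            + apply exp_decay; lra.
            + apply Rle_Rpower_l; lra.
          - rewrite <- Rpower_plus.
            replace (- (sigma + 1) + sigma) with (- (1)) by ring.
            rewrite Rpower_Ropp, Rpower_1; lra. }
        rewrite Rabs_mult, Rmult_comm, (Rabs_pos_eq (exp (- t) * _)), Rmult_assoc by nra.
        apply Rmult_le_compat; [apply Rabs_pos|nra|apply trig_bound|exact Hd].
      + apply filterlim_const.
      + set (M := K * exp_decay_bound (sigma + 1)).
        replace (Finite 0) with (Rbar_mult (Finite M) (Finite 0)) by (simpl; f_equal; ring).
        apply (is_lim_scal_l (fun t => / (1 + t)) M p_infty 0).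
        replace (Finite 0) with (Rbar_inv p_infty) by reflexivity.
        apply is_lim_inv; [|discriminate].
        apply is_lim_plus with 1 p_infty; [apply is_lim_const|apply is_lim_id|reflexivity]. }
  pose proof (is_improper_comb 1 (-1) _ _ _ _ (gamma_int_correct c' d' sigma tau Hs)
                (gamma_int_correct c d (sigma + 1) tau ltac:(lra))) as Hcomb.
  pose proof (is_improper_unique _ _ _ Hparts Hcomb); lra.
Qed.

Lemma is_improper_C (f : R -> C) (x y : R) :
  is_improper (fun t => fst (f t)) x -> is_improper (fun t => snd (f t)) y ->
  is_RInt_gen (V := C_R_NormedModule) f (at_right 0) (Rbar_locally p_infty) (x, y).
Proof.
  intros Hx Hy P [eps Heps].
  specialize (Hx _ (locally_ball x eps)); specialize (Hy _ (locally_ball y eps)).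
  unfold filtermapi in *.
  apply filter_imp with (2 := filter_and _ _ Hx Hy).
  intros ab [(x' & Hx' & Hbx) (y' & Hy' & Hby)].
  exists (x', y'); split.
  - now apply (is_RInt_fct_extend_pair (U := R_NormedModule) (V := R_NormedModule)).
  - apply Heps; now split.
Qed.

Definition gamma_integrand (s : C) (t : R) : C := (exp (- t) * Cpower t (s - 1))%C.

Lemma gamma_integrand_kernel (s : C) (t : R) :
  gamma_integrand s t
  = (gamma_kernel 1 0 (Re s) (Im s) t, gamma_kernel 0 1 (Re s) (Im s) t).
Proof.
  destruct s as [sigma tau].
  unfold gamma_integrand, Cpower, gamma_kernel, trig, Cminus, Cmult, Cplus, Copp, Re, Im; simpl.
  replace (sigma + - (1)) with (sigma - 1) by ring.
  replace (tau + - 0) with tau by ring.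
  f_equal; ring.
Qed.

Lemma Gamma_correct (s : C) : 0 < Re s ->
  is_RInt_gen (V := C_R_NormedModule) (gamma_integrand s) (at_right 0)
    (Rbar_locally p_infty) (gamma_int 1 0 (Re s) (Im s), gamma_int 0 1 (Re s) (Im s)).
Proof.
  intros Hs; apply is_improper_C.
  - apply is_improper_ext with (gamma_kernel 1 0 (Re s) (Im s)).
    + intros t _; now rewrite gamma_integrand_kernel.
    + now apply gamma_int_correct.
  - apply is_improper_ext with (gamma_kernel 0 1 (Re s) (Im s)).
    + intros t _; now rewrite gamma_integrand_kernel.
    + now apply gamma_int_correct.
Qed.

Lemma Gamma_int (s : C) : 0 < Re s ->
  Gamma s = (gamma_int 1 0 (Re s) (Im s), gamma_int 0 1 (Re s) (Im s)).
Proof.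
  intros Hs.
  exact (is_RInt_gen_unique (V := C_R_CompleteNormedModule) _ _ (Gamma_correct s Hs)).
Qed.

Lemma Gamma_succ (s : C) : 0 < Re s -> Gamma (s + 1) = (s * Gamma s)%C.
Proof.
  intros Hs.
  destruct s as [sigma tau]; simpl in Hs.
  rewrite !Gamma_int by (simpl; lra); simpl.
  rewrite Rplus_0_r, !gamma_int_succ by assumption.
  rewrite (gamma_int_linear (_ + _)), (gamma_int_linear (sigma * 0 + _)) by assumption.
  unfold Cmult; simpl; f_equal; ring.
Qed.

Lemma Gamma_poch (s : C) (n : nat) : 0 < Re s -> Gamma (s + INR n) = (poch s n * Gamma s)%C.
Proof.
  intros Hs; induction n as [|n IH].
  - simpl; rewrite Cplus_0_r; ring.
  - rewrite S_INR, RtoC_plus, Cplus_assoc, Gamma_succ, IH.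
    + simpl; ring.
    + pose proof (pos_INR n); destruct s; simpl in *; lra.
Qed.

Definition real_Gamma (x : R) : R := gamma_int 1 0 x 0.

Lemma real_Gamma_correct (x : R) : 0 < x ->
  is_improper (fun t => exp (- t) * Rpower t (x - 1)) (real_Gamma x).
Proof.
  intros Hx; apply is_improper_ext with (gamma_kernel 1 0 x 0).
  - intros t _; unfold gamma_kernel, trig; rewrite Rmult_0_l, cos_0; ring.
  - now apply gamma_int_correct.
Qed.

Lemma Gamma_RtoC (x : R) : 0 < x -> Gamma x = real_Gamma x.
Proof.
  intros Hx; rewrite Gamma_int by exact Hx; unfold RtoC, real_Gamma; simpl; f_equal.
  apply gamma_int_unique.
  apply is_improper_ext with (fun t => 0 * gamma_kernel 1 0 x 0 t + 0 * gamma_kernel 1 0 x 0 t).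
  - intros t _; unfold gamma_kernel, trig; rewrite !Rmult_0_l, sin_0; ring.
  - pose proof (gamma_int_correct 1 0 x 0 Hx) as H1.
    pose proof (is_improper_comb 0 0 _ _ _ _ H1 H1) as H0.
    now rewrite !Rmult_0_l, Rplus_0_l in H0.
Qed.

Lemma real_Gamma_ge_0 (x : R) : 0 < x -> 0 <= real_Gamma x.
Proof.
  intros Hx; refine (is_improper_ge_0 _ _ _ (real_Gamma_correct x Hx)).
  intros t _; apply Rmult_le_pos; left; apply exp_pos.
Qed.

Lemma Gamma_Cmod_le (s : C) : 0 < Re s -> Cmod (Gamma s) <= real_Gamma (Re s).
Proof.
  intros Hs; rewrite Gamma_int by assumption; rewrite Cmod_norm.
  refine (RInt_gen_norm (V := C_R_CompleteNormedModule) (gamma_integrand s)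
            (fun t => exp (- t) * Rpower t (Re s - 1)) _ _ _ _
            (Gamma_correct s Hs) (real_Gamma_correct (Re s) Hs)).
  - now apply eventually_positive_interval.
  - apply eventually_positive_interval; intros a b Ha Hab t Ht.
    change (@norm R_AbsRing C_R_NormedModule (gamma_integrand s t)
            <= exp (- t) * Rpower t (Re s - 1)).
    rewrite <- Cmod_norm, gamma_integrand_kernel.
    unfold Cmod, gamma_kernel, trig; simpl.
    pose proof (sin2_cos2 (Im s * ln t)) as Htrig; unfold Rsqr in Htrig.
    set (q := exp (- t) * Rpower t (Re s - 1)).
    assert (Hq : 0 <= q) by (apply Rmult_le_pos; left; apply exp_pos).
    apply Rle_trans with (sqrt (q * q)); [|rewrite sqrt_square by exact Hq; lra].
    apply sqrt_le_1_alt.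
    set (cs := cos _) in *; set (sn := sin _) in *.
    replace (q * q) with (q * q * (sn * sn + cs * cs)) by (rewrite Htrig; ring).
    right; ring.
Qed.

Lemma real_Gamma_1 : real_Gamma 1 = 1.
Proof.
  apply (is_improper_unique (fun t => exp (- t) * Rpower t (1 - 1))).
  - apply real_Gamma_correct; lra.
  - apply is_improper_ext with (fun t => exp (- t)).
    + intros t Ht; unfold Rpower; replace ((1 - 1) * ln t) with 0 by ring; rewrite exp_0; ring.
    + replace 1 with (- 0 - -1) by ring.
      apply is_improper_FTC with (fun t => - exp (- t)).
      * intros t _; auto_derive; [trivial|ring].
      * intros t _; apply (ex_derive_continuous (K := R_AbsRing) (V := R_NormedModule)).
        auto_derive; trivial.
      * assert (Hc : continuous (fun t => - exp (- t)) 0).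
        { apply (ex_derive_continuous (K := R_AbsRing) (V := R_NormedModule)).
          auto_derive; trivial. }
        replace (-1) with (- exp (- 0)) by (rewrite Ropp_0, exp_0; ring).
        intros P HP; apply filter_le_within; exact (Hc P HP).
      * apply (is_lim_opp (fun t => exp (- t)) p_infty 0).
        apply (is_lim_comp exp Ropp p_infty 0 m_infty).
        -- exact is_lim_exp_m.
        -- apply (is_lim_opp (fun t => t) p_infty p_infty), is_lim_id.
        -- exists 0; now intros.
Qed.

Lemma real_Gamma_succ (x : R) : 0 < x -> real_Gamma (x + 1) = x * real_Gamma x.
Proof.
  intros Hx; unfold real_Gamma.
  rewrite gamma_int_succ, gamma_int_linear by assumption; ring.
Qed.

(** Log-convexity in the form that is needed: [t ^ x] and [t ^ y] increase
    together, so [(t ^ x - c ^ x) (t ^ y - c ^ y) >= 0] for every [c], and one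
    integrates this against [exp (- t) t ^ (m - 1)].  The choice
    [c ^ x = Gamma (m + x) / Gamma m] makes two of the four terms cancel. *)
Lemma real_Gamma_supermultiplicative (m x y : R) :
  0 < m -> 0 < x -> 0 < y -> 0 < real_Gamma m ->
  real_Gamma (m + x) * real_Gamma (m + y) <= real_Gamma m * real_Gamma (m + x + y).
Proof.
  intros Hm Hx Hy HG.
  destruct (Rle_lt_or_eq_dec 0 (real_Gamma (m + x))) as [Hpos|Hzero];
    [apply real_Gamma_ge_0; lra| |].
  2: { rewrite <- Hzero, Rmult_0_l.
       apply Rmult_le_pos; apply real_Gamma_ge_0; lra. }
  set (q := real_Gamma (m + x) / real_Gamma m).
  assert (Hq : 0 < q) by (apply Rdiv_lt_0_compat; assumption).
  set (c := Rpower q (/ x)).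
  assert (Hc : 0 < c) by apply exp_pos.
  assert (Hcx : Rpower c x = q).
  { unfold c; rewrite Rpower_mult, Rinv_l, Rpower_1; lra. }
  set (p := Rpower c y).
  assert (Hint : is_improper
    (fun t => 1 * (1 * (exp (- t) * Rpower t (m + x + y - 1))
                   + - p * (exp (- t) * Rpower t (m + x - 1)))
            + - q * (1 * (exp (- t) * Rpower t (m + y - 1))
                   + - p * (exp (- t) * Rpower t (m - 1))))
    (1 * (1 * real_Gamma (m + x + y) + - p * real_Gamma (m + x))
     + - q * (1 * real_Gamma (m + y) + - p * real_Gamma m))).
  { pose proof (real_Gamma_correct (m + x + y) ltac:(lra)) as Hxy.
    pose proof (real_Gamma_correct (m + x) ltac:(lra)) as Hmx.
    pose proof (real_Gamma_correct (m + y) ltac:(lra)) as Hmy.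
    pose proof (real_Gamma_correct m Hm) as Hm'.
    exact (is_improper_comb 1 (- q) _ _ _ _ (is_improper_comb 1 (- p) _ _ _ _ Hxy Hmx)
             (is_improper_comb 1 (- p) _ _ _ _ Hmy Hm')). }
  apply is_improper_ge_0 in Hint.
  - assert (Hqm : q * real_Gamma m = real_Gamma (m + x)) by (unfold q; field; lra).
    assert (Hge : 0 <= real_Gamma (m + x + y) - q * real_Gamma (m + y)).
    { replace (real_Gamma (m + x + y) - q * real_Gamma (m + y))
        with (1 * (1 * real_Gamma (m + x + y) + - p * real_Gamma (m + x))
              + - q * (1 * real_Gamma (m + y) + - p * real_Gamma m));
      [exact Hint|rewrite <- Hqm; ring]. }
    rewrite <- Hqm; nra.
  - intros t Ht.
    replace (m + x + y - 1) with ((m - 1) + x + y) by ring.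
    replace (m + x - 1) with ((m - 1) + x) by ring.
    replace (m + y - 1) with ((m - 1) + y) by ring.
    rewrite !Rpower_plus.
    set (w := exp (- t) * Rpower t (m - 1)).
    assert (Hw : 0 <= w) by (apply Rmult_le_pos; left; apply exp_pos).
    assert (Hprod : 0 <= (Rpower t x - q) * (Rpower t y - p)).
    { rewrite <- Hcx; unfold p.
      destruct (Rle_or_lt c t) as [H|H].
      - apply Rmult_le_pos; apply Rge_le, Rge_minus, Rle_ge, Rle_Rpower_l; lra.
      - assert (Rpower t x <= Rpower c x) by (apply Rle_Rpower_l; lra).
        assert (Rpower t y <= Rpower c y) by (apply Rle_Rpower_l; lra).
        nra. }
    replace (1 * _ + _) with (w * ((Rpower t x - q) * (Rpower t y - p)))
      by (unfold w; ring).
    now apply Rmult_le_pos.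
Qed.

Lemma real_Gamma_add_pos (x : R) (n : nat) :
  0 < x -> 0 < real_Gamma x -> 0 < real_Gamma (x + INR n).
Proof.
  intros Hx HG; induction n as [|n IH].
  - now rewrite Rplus_0_r.
  - pose proof (pos_INR n).
    rewrite S_INR, <- Rplus_assoc, real_Gamma_succ by lra.
    apply Rmult_lt_0_compat; lra.
Qed.

(** The bound [A <= 1 / (n Beta a b)] is asymptotically sharp, but valid for each
    [n]: by the functional equation, [A * Beta a b] is
    [Gamma (a + n) Gamma (b + n) / (Gamma (a + b + n) n!)], where passing to the
    real parts of [a] and [b] enlarges the numerator, and then log-convexity bounds
    the quotient by [Gamma n / n!]. *)
Lemma hyp_coef_beta_bound (a b : C) (s : R) (A : R) (n : nat) :
  0 < Re a -> 0 < Re b -> (a + b)%C = s -> (1 <= n)%nat ->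
  hyp_coef a b (a + b) n = A -> 0 <= A -> 1 <= Re (Beta a b) -> INR n * A <= 1.
Proof.
  intros Ha Hb Hs Hn HA HA0 HB.
  assert (Hn0 : 0 < INR n) by (apply lt_0_INR; lia).
  assert (Hs_eq : s = Re a + Re b) by (rewrite <- re_plus, Hs; reflexivity).
  assert (Hs0 : 0 < s) by lra.
  assert (HGs : Gamma (a + b) = real_Gamma s) by (rewrite Hs; now apply Gamma_RtoC).
  assert (Hg : 0 < real_Gamma s).
  { destruct (Rle_lt_or_eq_dec 0 (real_Gamma s)) as [H|H];
      [now apply real_Gamma_ge_0|exact H|exfalso].
    (* division by zero gives zero, so [Beta a b] would be [0] *)
    unfold Beta in HB; rewrite HGs, <- H in HB.
    revert HB; generalize (Gamma a * Gamma b)%C; intros [p q].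
    unfold Cdiv, Cinv, Cmult, RtoC; simpl.
    rewrite !Rmult_0_l, Ropp_0; unfold Rdiv; rewrite !Rmult_0_l, !Rmult_0_r; lra. }
  assert (Hg1 : 0 < real_Gamma 1) by (rewrite real_Gamma_1; lra).
  pose proof (real_Gamma_add_pos s n Hs0 Hg) as Hgsn.
  pose proof (real_Gamma_add_pos 1 n Rlt_0_1 Hg1) as Hg1n.
  assert (Hgn : 0 < real_Gamma (INR n)).
  { rewrite Rplus_comm, real_Gamma_succ in Hg1n by assumption.
    apply Rmult_lt_reg_l with (INR n); lra. }
  pose proof (Gamma_poch a n Ha) as Hpa.
  pose proof (Gamma_poch b n Hb) as Hpb.
  pose proof (Gamma_poch (RtoC s) n Hs0) as Hps.
  pose proof (Gamma_poch (RtoC 1) n Rlt_0_1) as Hp1.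
  rewrite <- RtoC_plus, !Gamma_RtoC in Hps, Hp1 by (try assumption; lra).
  rewrite real_Gamma_1, Cmult_1_r in Hp1.
  assert (Hnz1 : poch 1 n <> 0%C).
  { rewrite <- Hp1; intros H; apply RtoC_inj in H; lra. }
  assert (Hnzs : poch s n <> 0%C).
  { intros H; rewrite H, Cmult_0_l in Hps; apply RtoC_inj in Hps; lra. }
  assert (Hnzg : RtoC (real_Gamma s) <> 0%C) by (intros H; apply RtoC_inj in H; lra).
  set (D := real_Gamma (s + INR n) * real_Gamma (1 + INR n)).
  assert (HD : 0 < D) by now apply Rmult_lt_0_compat.
  assert (HDnz : RtoC D <> 0%C) by (intros H; apply RtoC_inj in H; lra).
  assert (Hprod : (RtoC (A * D) * Beta a b = Gamma (a + INR n) * Gamma (b + INR n))%C).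
  { unfold D, Beta; rewrite !RtoC_mult, <- HA, HGs, Hpa, Hpb, Hps, Hp1, Hs.
    unfold hyp_coef.
    field; repeat split; assumption. }
  assert (Hle : A * D * Re (Beta a b) <= real_Gamma (INR n) * real_Gamma (s + INR n)).
  { apply Rle_trans with (Cmod (Gamma (a + INR n) * Gamma (b + INR n))).
    - rewrite <- Hprod.
      eapply Rle_trans; [|apply re_le_Cmod]; eapply Rle_trans; [|apply Rle_abs].
      right; generalize (Beta a b); intros [p q]; simpl; ring.
    - rewrite Cmod_mult.
      assert (Hra : Re (a + INR n) = INR n + Re a) by (destruct a; simpl; ring).
      assert (Hrb : Re (b + INR n) = INR n + Re b) by (destruct b; simpl; ring).
      pose proof (Gamma_Cmod_le (a + INR n)) as Hca.
      pose proof (Gamma_Cmod_le (b + INR n)) as Hcb.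
      rewrite Hra in Hca; rewrite Hrb in Hcb.
      pose proof (real_Gamma_supermultiplicative (INR n) (Re a) (Re b) Hn0 Ha Hb Hgn) as Hsup.
      replace (INR n + Re a + Re b) with (s + INR n) in Hsup by lra.
      eapply Rle_trans; [|exact Hsup].
      apply Rmult_le_compat; try apply Cmod_ge_0; [apply Hca|apply Hcb]; lra. }
  assert (Hmono : A * D * 1 <= A * D * Re (Beta a b)).
  { apply Rmult_le_compat_l; [apply Rmult_le_pos; lra|assumption]. }
  unfold D in Hle, Hmono.
  rewrite (Rplus_comm 1 (INR n)), real_Gamma_succ in Hle, Hmono by assumption.
  apply Rmult_le_reg_r with (real_Gamma (INR n) * real_Gamma (s + INR n)).
  - now apply Rmult_lt_0_compat.
  - lra.
Qed.

(** * Coefficients of the hypergeometric functions *)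

Lemma poch_positive (x : R) (n : nat) : 0 < x -> exists y : R, 0 < y /\ poch x n = y.
Proof.
  intros Hx; induction n as [|n (y & Hy & Heq)].
  - exists 1; split; [lra|reflexivity].
  - exists (y * (x + INR n)); split.
    + pose proof (pos_INR n); apply Rmult_lt_0_compat; lra.
    + simpl; rewrite Heq, RtoC_mult, RtoC_plus; reflexivity.
Qed.

Lemma poch_neq_0 (x : R) (n : nat) : 0 < x -> poch x n <> 0%C.
Proof.
  intros Hx; destruct (poch_positive x n Hx) as (y & Hy & ->).
  intros H; apply RtoC_inj in H; lra.
Qed.

Lemma RtoC_neq_0 (x : R) : x <> 0 -> RtoC x <> 0%C.
Proof. intros Hx H; apply Hx; now apply RtoC_inj. Qed.

(** The coefficients of [F(a, b; a + b; z)], which depend on [a] and [b] only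
    through [s = a + b] and [p = a b]; so they are real in the conjugate case
    as well. *)
Fixpoint zero_balanced_coef (s p : R) (n : nat) : R :=
  match n with
  | O => 1
  | S m => zero_balanced_coef s p m * ((INR m * INR m + s * INR m + p)
                                       / ((s + INR m) * (1 + INR m)))
  end.

Lemma hyp_coef_zero_balanced (a b : C) (s p : R) (n : nat) :
  (a + b)%C = s -> (a * b)%C = p -> 0 < s ->
  hyp_coef a b (a + b) n = zero_balanced_coef s p n.
Proof.
  intros Hs Hp Hs0; rewrite Hs.
  induction n as [|n IH].
  - unfold hyp_coef; simpl; field; apply RtoC_neq_0; lra.
  - pose proof (pos_INR n) as Hn.
    simpl zero_balanced_coef; rewrite RtoC_mult, <- IH.
    rewrite RtoC_div, !RtoC_plus, !RtoC_mult, !RtoC_plus, <- Hp by nra.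
    replace (INR n * INR n + s * INR n + a * b)%C with ((a + INR n) * (b + INR n))%C
      by (rewrite <- Hs; ring).
    unfold hyp_coef; simpl.
    assert (H1 : poch 1 n <> 0%C) by (apply poch_neq_0; lra).
    assert (H2 : poch s n <> 0%C) by (apply poch_neq_0; lra).
    assert (H3 : (s + INR n)%C <> 0%C) by (rewrite <- RtoC_plus; apply RtoC_neq_0; lra).
    assert (H4 : (1 + INR n)%C <> 0%C) by (rewrite <- RtoC_plus; apply RtoC_neq_0; lra).
    field; repeat split; assumption.
Qed.

(** [(2, n) / (1, n) = n + 1], and the factors of [(j, n) / (j + 1, n)] cancel
    except for the first and the last. *)
Lemma hyp_coef_weight (j n : nat) : (1 <= j)%nat ->
  hyp_coef 2 (INR j) (INR (j + 1)) n = (INR (S n) * INR j / (INR j + INR n))%C.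
Proof.
  intros Hj.
  assert (Hj0 : 0 < INR j) by (apply lt_0_INR; lia).
  pose proof (pos_INR n) as Hn.
  assert (H2 : poch 2 n = (poch 1 n * INR (S n))%C).
  { induction n as [|n IH]; [simpl; ring|].
    simpl poch; rewrite IH by apply pos_INR; rewrite (S_INR (S n)), (S_INR n), !RtoC_plus; ring. }
  assert (Hx : (poch (INR j) n * (INR j + INR n))%C = (INR j * poch (INR j + 1) n)%C).
  { clear; induction n as [|n IH]; [simpl; ring|].
    simpl poch; rewrite Cmult_assoc, <- IH, S_INR, RtoC_plus; ring. }
  rewrite plus_INR, RtoC_plus; unfold hyp_coef; rewrite H2.
  assert (H1 : poch 1 n <> 0%C) by (apply poch_neq_0; lra).
  assert (H3 : poch (INR j + 1) n <> 0%C)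
    by (rewrite <- RtoC_plus; apply poch_neq_0; lra).
  assert (H4 : (INR j + INR n)%C <> 0%C) by (rewrite <- RtoC_plus; apply RtoC_neq_0; lra).
  change (INR 1) with 1.
  replace (poch (INR j) n) with (INR j * poch (INR j + 1) n / (INR j + INR n))%C
    by (rewrite <- Hx; field; assumption).
  field; repeat split; assumption.
Qed.

(** * Power series with coefficients of small variation *)

Lemma variation_bound (B : nat -> R) (N : nat) :
  Rabs (B N) <= Rabs (B O) + sum_n (fun n => Rabs (B (S n) - B n)) N.
Proof.
  assert (Hle : Rabs (B (S N)) <= Rabs (B O) + sum_n (fun n => Rabs (B (S n) - B n)) N /\
    Rabs (B N) <= Rabs (B O) + sum_n (fun n => Rabs (B (S n) - B n)) N).
  { induction N as [|N [IH _]].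
    - rewrite sum_O; pose proof (Rabs_triang (B O) (B 1%nat - B O)) as H.
      replace (B O + (B 1%nat - B O)) with (B 1%nat) in H by ring.
      pose proof (Rabs_pos (B 1%nat - B O)); split; lra.
    - rewrite sum_Sn; unfold plus; simpl.
      pose proof (Rabs_triang (B (S N)) (B (S (S N)) - B (S N))) as H.
      replace (B (S N) + (B (S (S N)) - B (S N))) with (B (S (S N))) in H by ring.
      pose proof (Rabs_pos (B (S (S N)) - B (S N))); split; lra. }
  apply Hle.
Qed.

(** A variant of the Enestrom-Kakeya theorem: if [sum_n B_n w^n = 0], then
    multiplication by [1 - w] gives [-1 = sum_n (B_{n+1} - B_n) w^(n+1)], while the
    modulus of the right-hand side is at most [|w|] times the total variation. *)
Lemma small_variation_nonvanishing (B : nat -> R) (w : C) :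
  B O = 1 -> (forall N, sum_n (fun n => Rabs (B (S n) - B n)) N <= 1) -> Cmod w < 1 ->
  unit_radius (fun n => RtoC (B n)) -> CPSeries (fun n => RtoC (B n)) w <> 0%C.
Proof.
  intros HB0 Hvar Hw Hrad H0.
  pose proof (CPSeries_correct _ w Hrad Hw) as Hsum; rewrite H0 in Hsum.
  assert (Htail : csum (fun n => (w ^ S n * B (S n))%C) (- (1))%C).
  { apply (is_series_incr_1 (K := C_AbsRing) (V := C_NormedModule)
             (fun n => (w ^ n * B n)%C)).
    match goal with |- is_series _ ?l => replace l with (RtoC 0) end; [exact Hsum|].
    change (RtoC 0 = - (1) + w ^ 0 * B O)%C; rewrite HB0; simpl; ring. }
  pose proof (csum_comb 1 (- w) _ _ _ _ Htail Hsum) as Hdiff.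
  replace (1 * - (1) + - w * 0)%C with (- (1))%C in Hdiff by ring.
  apply csum_partial_sums in Hdiff.
  rewrite Cmod_opp, Cmod_1 in Hdiff.
  assert (Hle : Rbar_le 1 (Cmod w)); [|simpl in Hle; lra].
  refine (is_lim_seq_le _ (fun _ => Cmod w) 1 (Cmod w) _ Hdiff (is_lim_seq_const _)).
  intros N.
  apply Rle_trans with (sum_n (fun n => Cmod w * Rabs (B (S n) - B n)) N).
  - eapply Rle_trans; [apply (norm_sum_n_m (K := C_AbsRing) (V := C_NormedModule))|].
    apply sum_n_m_le; intros n.
    change (Cmod (1 * (w ^ S n * B (S n)) + - w * (w ^ n * B n))
            <= Cmod w * Rabs (B (S n) - B n)).
    replace (1 * (w ^ S n * B (S n)) + - w * (w ^ n * B n))%C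
      with (w * w ^ n * (B (S n) - B n)%R)%C by (rewrite RtoC_minus; simpl; ring).
    rewrite !Cmod_mult, Cmod_pow, Cmod_R.
    assert (Cmod w ^ n <= 1).
    { rewrite <- (pow1 n); apply pow_incr; split; [apply Cmod_ge_0|lra]. }
    pose proof (Cmod_ge_0 w); pose proof (Rabs_pos (B (S n) - B n)).
    apply Rmult_le_compat_r; nra.
  - replace (sum_n (fun n => Cmod w * Rabs (B (S n) - B n)) N)
      with (Cmod w * sum_n (fun n => Rabs (B (S n) - B n)) N)
      by (symmetry; apply (sum_n_mult_l (K := R_Ring))).
    pose proof (Cmod_ge_0 w); specialize (Hvar N); nra.
Qed.

(** Coefficients, in [z ^ 2], of the derivative of [z F(a, b; a + b; z ^ 2)]. *)
Definition derivative_coef (s p : R) (n : nat) : R :=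
  (2 * INR n + 1) * zero_balanced_coef s p n.

Lemma zero_balanced_coef_positive (s p : R) (n : nat) :
  0 < s -> 0 < p -> 0 < zero_balanced_coef s p n.
Proof.
  intros Hs Hp; induction n as [|n IH]; simpl; [lra|].
  pose proof (pos_INR n).
  apply Rmult_lt_0_compat; [assumption|apply Rdiv_lt_0_compat; nra].
Qed.

Lemma derivative_coef_positive (s p : R) (n : nat) :
  0 < s -> 0 < p -> 0 < derivative_coef s p n.
Proof.
  intros Hs Hp; pose proof (pos_INR n).
  apply Rmult_lt_0_compat; [lra|now apply zero_balanced_coef_positive].
Qed.

(** The sign of the increments is the sign of [(2 p - 1) n + (3 p - s)]: the two
    hypotheses on [a b] say that it is constant. *)
Lemma derivative_coef_increment (s p : R) (n : nat) : 0 < s ->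
  derivative_coef s p (S n) - derivative_coef s p n
  = zero_balanced_coef s p n / ((s + INR n) * (1 + INR n))
    * ((2 * p - 1) * INR n + (3 * p - s)).
Proof.
  intros Hs; pose proof (pos_INR n).
  unfold derivative_coef; simpl zero_balanced_coef; rewrite S_INR.
  field; lra.
Qed.

Lemma increment_factor_positive (s p : R) (n : nat) : 0 < s -> 0 < p ->
  0 < zero_balanced_coef s p n / ((s + INR n) * (1 + INR n)).
Proof.
  intros Hs Hp; pose proof (pos_INR n).
  apply Rdiv_lt_0_compat; [now apply zero_balanced_coef_positive|nra].
Qed.

Lemma derivative_coef_O (s p : R) : derivative_coef s p 0 = 1.
Proof. unfold derivative_coef; simpl; ring. Qed.

Lemma monotone_variation (B : nat -> R) (e : R) (N : nat) :
  (forall n, Rabs (B (S n) - B n) = e * (B (S n) - B n)) ->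
  sum_n (fun n => Rabs (B (S n) - B n)) N = e * (B (S N) - B O).
Proof.
  intros He; induction N as [|N IH].
  - now rewrite sum_O, He.
  - rewrite sum_Sn, IH, He; unfold plus; simpl; ring.
Qed.

Lemma decreasing_variation (s p : R) (N : nat) :
  0 < s -> 0 < p -> p <= 1 / 2 -> p <= s / 3 ->
  sum_n (fun n => Rabs (derivative_coef s p (S n) - derivative_coef s p n)) N <= 1.
Proof.
  intros Hs Hp H1 H2.
  rewrite (monotone_variation _ (-1)).
  - rewrite derivative_coef_O.
    pose proof (derivative_coef_positive s p (S N) Hs Hp); lra.
  - intros n; rewrite Rabs_left1; [ring|].
    rewrite derivative_coef_increment by assumption.
    pose proof (increment_factor_positive s p n Hs Hp); pose proof (pos_INR n).
    assert ((2 * p - 1) * INR n <= 0) by nra.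
    assert ((2 * p - 1) * INR n + (3 * p - s) <= 0) by lra; nra.
Qed.

(** The variation up to [N] is [B_{N+1} - 1], and [B_{N+1} <= B_m] for all larger
    [m]; the last hypothesis says that [B_m <= 2 + 1 / m]. *)
Lemma increasing_variation (s p : R) (N : nat) :
  0 < s -> 0 < p -> 1 / 2 <= p -> s / 3 <= p ->
  (forall n, (1 <= n)%nat -> INR n * zero_balanced_coef s p n <= 1) ->
  sum_n (fun n => Rabs (derivative_coef s p (S n) - derivative_coef s p n)) N <= 1.
Proof.
  intros Hs Hp H1 H2 Hlim.
  assert (Hinc : forall n, derivative_coef s p n <= derivative_coef s p (S n)).
  { intros n; apply Rminus_le_0.
    rewrite derivative_coef_increment by assumption.
    pose proof (increment_factor_positive s p n Hs Hp); pose proof (pos_INR n).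
    apply Rmult_le_pos; [lra|nra]. }
  assert (Hmono : forall n m, derivative_coef s p n <= derivative_coef s p (n + m)).
  { intros n m; induction m as [|m IH].
    - rewrite Nat.add_0_r; lra.
    - rewrite Nat.add_succ_r; eapply Rle_trans; [exact IH|apply Hinc]. }
  rewrite (monotone_variation _ 1).
  2: { intros n; rewrite Rabs_pos_eq; [ring|]; specialize (Hinc n); lra. }
  rewrite derivative_coef_O.
  enough (derivative_coef s p (S N) <= 2) by lra.
  apply le_epsilon; intros eps Heps.
  destruct (archimed_cor1 eps Heps) as (M & HM & HM0).
  assert (HM1 : 0 < INR M) by (apply lt_0_INR; lia).
  eapply Rle_trans; [apply (Hmono (S N) M)|].
  set (m := (S N + M)%nat).
  assert (HmM : INR M <= INR m) by (apply le_INR; unfold m; lia).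
  specialize (Hlim m ltac:(unfold m; lia)).
  apply Rle_trans with (2 + / INR m).
  - unfold derivative_coef.
    apply Rmult_le_reg_l with (INR m); [lra|].
    replace (INR m * (2 + / INR m)) with (2 * INR m + 1) by (field; lra).
    nra.
  - assert (/ INR m <= / INR M) by (apply Rinv_le_contravar; lra); lra.
Qed.

(** * The coordinate functions *)

Lemma deriv_coef_comb (x y : C) (u v : nat -> C) (z : C) :
  unit_radius u -> unit_radius v -> Cmod z < 1 ->
  CPSeries (deriv_coef (fun n => (x * u n + y * v n)%C)) z
  = (x * CPSeries (deriv_coef u) z + y * CPSeries (deriv_coef v) z)%C.
Proof.
  intros Hu Hv Hz.
  rewrite <- CPSeries_comb by auto using unit_radius_deriv.
  apply CPSeries_ext; [|now apply unit_radius_comb; apply unit_radius_deriv|exact Hz].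
  intros n; unfold deriv_coef; ring.
Qed.

Lemma deriv_coef_scal (x : C) (u : nat -> C) (z : C) :
  unit_radius u -> Cmod z < 1 ->
  CPSeries (deriv_coef (fun n => (x * u n)%C)) z = (x * CPSeries (deriv_coef u) z)%C.
Proof.
  intros Hu Hz.
  rewrite <- CPSeries_scal by auto using unit_radius_deriv.
  apply CPSeries_ext; [|now apply unit_radius_scal, unit_radius_deriv|exact Hz].
  intros n; unfold deriv_coef; ring.
Qed.

Lemma Cmod_shift_bound (j : nat) (u : nat -> C) (M : R) :
  0 <= M -> (forall n, Cmod (u n) <= M) -> forall n, Cmod (shift_coef j u n) <= M.
Proof.
  intros HM H n; unfold shift_coef; destruct (n <? j)%nat; [now rewrite Cmod_0|apply H].
Qed.

Lemma CPSeries_deriv_shift (i : nat) (u v : nat -> C) (z : C) :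
  (forall n, (INR (S (n + i)) * u n)%C = v n) -> unit_radius v -> Cmod z < 1 ->
  CPSeries (deriv_coef (shift_coef (S i) u)) z = (z ^ i * CPSeries v z)%C.
Proof.
  intros Huv Hv Hz; apply CPSeries_unique.
  apply csum_ext with (fun n => (z ^ n * shift_coef i v n)%C); [|now apply csum_shift].
  intros n; f_equal; unfold deriv_coef, shift_coef.
  change (S n <? S i)%nat with (n <? i)%nat.
  destruct (Nat.ltb_spec n i) as [H|H]; [ring|].
  rewrite <- Huv; replace (n - i + i)%nat with n by lia; reflexivity.
Qed.

Lemma Ci_squared : (Ci * Ci = - (1))%C.
Proof. unfold Ci, Cmult, Copp, RtoC; simpl; f_equal; ring. Qed.

(** Coefficients of [beta z ^ j / j * (E * F(2, j; j + 1; z))], where [E] has the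
    coefficients [e]: the primitive of [beta z ^ (j - 1) (z E(z))']. *)
Definition component_coef (beta : C) (j : nat) (e : nat -> C) : nat -> C :=
  shift_coef j (fun n => (beta / INR j
                          * hadamard e (hyp_coef 2 (INR j) (INR (j + 1))) n)%C).

Lemma hadamard_weight_bound (e : nat -> C) (M : R) (j n : nat) :
  (1 <= j)%nat -> (forall m, Cmod (INR (S m) * e m) <= M) ->
  Cmod (hadamard e (hyp_coef 2 (INR j) (INR (j + 1))) n) <= M.
Proof.
  intros Hj He.
  assert (Hj0 : 0 < INR j) by (apply lt_0_INR; lia).
  pose proof (pos_INR n) as Hn.
  unfold hadamard; rewrite hyp_coef_weight by exact Hj.
  replace (e n * (INR (S n) * INR j / (INR j + INR n)))%C
    with (INR (S n) * e n * (INR j / (INR j + INR n))%R)%C.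
  - rewrite Cmod_mult, Cmod_R.
    assert (H0 : 0 <= INR j / (INR j + INR n)) by (apply Rdiv_le_0_compat; lra).
    assert (H1 : INR j / (INR j + INR n) <= 1) by (apply Rle_div_l; lra).
    rewrite Rabs_pos_eq by exact H0.
    specialize (He n); pose proof (Cmod_ge_0 (INR (S n) * e n)); nra.
  - rewrite RtoC_div, RtoC_plus by lra.
    field; rewrite <- RtoC_plus; apply RtoC_neq_0; lra.
Qed.

Lemma component_coef_unit_radius (beta : C) (j : nat) (e : nat -> C) (M : R) :
  (1 <= j)%nat -> (forall m, Cmod (INR (S m) * e m) <= M) ->
  unit_radius (component_coef beta j e).
Proof.
  intros Hj He.
  assert (HM : 0 <= M) by (eapply Rle_trans; [apply Cmod_ge_0|apply (He O)]).
  apply bounded_unit_radius with (Cmod (beta / INR j) * M).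
  apply Cmod_shift_bound.
  - apply Rmult_le_pos; [apply Cmod_ge_0|exact HM].
  - intros n; rewrite Cmod_mult; apply Rmult_le_compat_l; [apply Cmod_ge_0|].
    now apply hadamard_weight_bound.
Qed.

Lemma component_series (beta : C) (j : nat) (e : nat -> C) (M : R) (z : C) :
  (1 <= j)%nat -> (forall m, Cmod (INR (S m) * e m) <= M) -> Cmod z < 1 ->
  CPSeries (component_coef beta j e) z
  = (beta * z ^ j / INR j * CPSeries (hadamard e (hyp_coef 2 (INR j) (INR (j + 1)))) z)%C.
Proof.
  intros Hj He Hz; unfold component_coef.
  assert (Hr : unit_radius (hadamard e (hyp_coef 2 (INR j) (INR (j + 1))))).
  { apply bounded_unit_radius with M; intros n; now apply hadamard_weight_bound. }
  rewrite CPSeries_shift by (try apply unit_radius_scal; assumption).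
  rewrite CPSeries_scal by assumption.
  unfold Cdiv; ring.
Qed.

(** The weight is chosen to make the derivatives of all three coordinates
    multiples of one and the same function. *)
Lemma component_derivative (beta : C) (i : nat) (e : nat -> C) (M : R) (z : C) :
  (forall m, Cmod (INR (S m) * e m) <= M) -> Cmod z < 1 ->
  CPSeries (deriv_coef (component_coef beta (S i) e)) z
  = (beta * z ^ i * CPSeries (fun m => (INR (S m) * e m)%C) z)%C.
Proof.
  intros He Hz.
  assert (Hr : unit_radius (fun m => (INR (S m) * e m)%C))
    by now apply bounded_unit_radius with M.
  unfold component_coef.
  rewrite (CPSeries_deriv_shift i _ (fun m => (beta * (INR (S m) * e m))%C)).
  - rewrite CPSeries_scal by assumption; ring.
  - intros n; unfold hadamard; rewrite hyp_coef_weight by lia.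
    assert (Hi : 0 < INR (S i)) by (apply lt_0_INR; lia).
    pose proof (pos_INR n).
    replace (S (n + i)) with (S i + n)%nat by lia; rewrite plus_INR, RtoC_plus.
    field; split.
    + rewrite <- RtoC_plus; apply RtoC_neq_0; lra.
    + apply RtoC_neq_0; lra.
  - now apply unit_radius_scal.
  - exact Hz.
Qed.

Lemma sum_product_real_positive (a b : C) :
  ((Im a = 0 /\ 0 < Re a /\ Im b = 0 /\ 0 < Re b) \/
   (a <> 0%C /\ 0 < Re a /\ b = Cconj a)) ->
  0 < Re a /\ 0 < Re b /\ (a + b)%C = Re (a + b) /\ (a * b)%C = Re (a * b) /\
  0 < Re (a + b) /\ 0 < Re (a * b).
Proof.
  destruct a as [x y], b as [x' y']; simpl.
  intros [(-> & Hx & -> & Hx')|(_ & Hx & Heq)].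
  - repeat split; try lra; try nra; unfold Cplus, Cmult, RtoC; simpl; f_equal; ring.
  - injection Heq as -> ->.
    repeat split; try lra; try nra; unfold Cplus, Cmult, RtoC; simpl; f_equal; ring.
Qed.

(** Either alternative gives a sequence of total variation at most [1].  In (ii)
    the bound on [|alpha|] is used through its consequence [Beta a b >= 1]. *)
Lemma derivative_coef_variation (a b alpha : C) (N : nat) :
  ((Im a = 0 /\ 0 < Re a /\ Im b = 0 /\ 0 < Re b) \/
   (a <> 0%C /\ 0 < Re a /\ b = Cconj a)) ->
  ((Re (a * b) <= Rmin (1 / 2) (Re (a + b) / 3) /\
    Cmod alpha * (Re (Beta a b) - 1) <= 1) \/
   (Re (a * b) >= Rmax (1 / 2) (Re (a + b) / 3) /\
    Cmod alpha <= Re (Beta a b) - 1)) ->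
  let B := derivative_coef (Re (a + b)) (Re (a * b)) in
  sum_n (fun n => Rabs (B (S n) - B n)) N <= 1.
Proof.
  intros Hab Hcond B.
  destruct (sum_product_real_positive a b Hab) as (Ha & Hb & Hs & Hp & Hs0 & Hp0).
  destruct Hcond as [[Hle _]|[Hge Halpha]].
  - pose proof (Rmin_l (1 / 2) (Re (a + b) / 3)); pose proof (Rmin_r (1 / 2) (Re (a + b) / 3)).
    apply decreasing_variation; lra.
  - pose proof (Rmax_l (1 / 2) (Re (a + b) / 3)); pose proof (Rmax_r (1 / 2) (Re (a + b) / 3)).
    apply increasing_variation; try lra.
    intros n Hn; apply (hyp_coef_beta_bound a b (Re (a + b))); try assumption.
    + now apply hyp_coef_zero_balanced.
    + left; now apply zero_balanced_coef_positive.
    + pose proof (Cmod_ge_0 alpha); lra.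
Qed.

Theorem corollary4 :
  forall (a b : C) (k : nat) (alpha sqrt_alpha : C) (c : R),
    ((Im a = 0 /\ 0 < Re a /\ Im b = 0 /\ 0 < Re b) \/
     (a <> 0%C /\ 0 < Re a /\ b = Cconj a)) ->
    (1 <= k)%nat ->
    (sqrt_alpha ^ 2 = alpha)%C ->
    (* [a * b], [a + b] and [Beta a b] are real numbers *)
    ((Re (a * b) <= Rmin (1 / 2) (Re (a + b) / 3) /\
      Cmod alpha * (Re (Beta a b) - 1) <= 1) \/
     (Re (a * b) >= Rmax (1 / 2) (Re (a + b) / 3) /\
      Cmod alpha <= Re (Beta a b) - 1)) ->
    let F2 := in_square (hyp_coef a b (a + b)) in
    let f := fun z : C =>
      (z * hypF a b (a + b) (z ^ 2)
       + Cconj (alpha * z ^ (2 * k + 1) / INR (2 * k + 1)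
                * CPSeries (hadamard F2
                    (hyp_coef 2 (INR (2 * k + 1)) (INR (2 * k + 2)))) z))%C in
    let t := fun z : C =>
      2 * Im (sqrt_alpha * z ^ (k + 1) / INR (k + 1)
              * CPSeries (hadamard F2
                  (hyp_coef 2 (INR (k + 1)) (INR (k + 2)))) z)%C + c in
    let X := fun z : C => (Re (f z), Im (f z), t z) in
    minimal_surface unit_disk X /\
    (forall z : C, unit_disk z -> base_projection (X z) = f z).
Proof.
  intros a b k alpha sqrt_alpha c Hab Hk Halpha Hcond F2 f t X.
  split.
  2: { intros z _; exact (eq_sym (surjective_pairing (f z))). }
  pose proof (fun N => derivative_coef_variation a b alpha N Hab Hcond) as Hvar.
  destruct (sum_product_real_positive a b Hab) as (Ha & Hb & Hs & Hp & Hs0 & Hp0).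
  set (s := Re (a + b)) in *; set (p := Re (a * b)) in *.
  simpl in Hvar.
  assert (HB2 : forall n, Rabs (derivative_coef s p n) <= 2).
  { intros n; eapply Rle_trans; [apply variation_bound|].
    rewrite derivative_coef_O, Rabs_R1; specialize (Hvar n); lra. }
  assert (Hcoef : forall n, hyp_coef a b (a + b) n = zero_balanced_coef s p n)
    by (intros n; now apply hyp_coef_zero_balanced).
  (* the coefficients of [Q], in powers of [z] and of [z ^ 2] *)
  set (q := fun m => (INR (S m) * F2 m)%C).
  set (B := fun n => RtoC (derivative_coef s p n)).
  assert (HqB : forall m, q m = in_square B m).
  { intros m; unfold q, F2, B, in_square.
    destruct (Nat.even m) eqn:Hm; [|ring].
    rewrite Hcoef; unfold derivative_coef; rewrite RtoC_mult; f_equal; f_equal.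
    apply Nat.even_spec in Hm; destruct Hm as [n ->].
    rewrite Nat.div2_double, S_INR, mult_INR; simpl; ring. }
  assert (Hq : forall m, Cmod (q m) <= 2).
  { intros m; rewrite HqB; unfold in_square, B.
    destruct (Nat.even m); [rewrite Cmod_R; apply HB2|rewrite Cmod_0; lra]. }
  assert (HrB : unit_radius B).
  { apply bounded_unit_radius with 2; intros n; unfold B; rewrite Cmod_R; apply HB2. }
  assert (HrA : unit_radius (hyp_coef a b (a + b))).
  { apply bounded_unit_radius with 2; intros n.
    eapply Rle_trans; [|apply (HB2 n)].
    rewrite Hcoef, Cmod_R; unfold derivative_coef; rewrite Rabs_mult.
    pose proof (pos_INR n); pose proof (Rabs_pos (zero_balanced_coef s p n)).
    rewrite (Rabs_pos_eq (2 * INR n + 1)) by lra; nra. }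
  assert (HrF2 : unit_radius F2).
  { apply bounded_unit_radius with 2; intros m.
    eapply Rle_trans; [|apply (Hq m)]; unfold q.
    rewrite Cmod_mult, Cmod_R, S_INR.
    pose proof (pos_INR m); pose proof (Cmod_ge_0 (F2 m)).
    rewrite Rabs_pos_eq by lra; nra. }
  assert (Hrq : unit_radius q) by now apply bounded_unit_radius with 2.
  assert (HQ : forall z, unit_disk z -> CPSeries q z <> 0%C).
  { intros z Hz.
    assert (Hz2 : Cmod (z ^ 2) < 1).
    { unfold unit_disk in Hz; rewrite Cmod_pow; pose proof (Cmod_ge_0 z); simpl; nra. }
    rewrite (CPSeries_unique q z (CPSeries (in_square B) z)).
    - rewrite CPSeries_in_square by assumption.
      apply small_variation_nonvanishing; auto using derivative_coef_O.
    - rewrite <- (CPSeries_ext q (in_square B)); try assumption.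
      + now apply CPSeries_correct.
      + now apply bounded_unit_radius with 2; intros m; rewrite <- HqB. }
  set (vh := shift_coef 1 F2).
  set (vg := component_coef alpha (2 * k + 1) F2).
  set (vt := component_coef sqrt_alpha (k + 1) F2).
  assert (Hvh : unit_radius vh).
  { intros r Hr; apply ex_series_incr_1.
    apply ex_series_ext with (fun n => r * (Cmod (F2 n) * r ^ n)).
    - intros n; unfold vh, shift_coef; simpl; rewrite Nat.sub_0_r; ring.
    - apply (ex_series_scal_l (K := R_AbsRing) (V := R_NormedModule)); now apply HrF2. }
  assert (Hvg : unit_radius vg) by (apply component_coef_unit_radius with 2; [lia|exact Hq]).
  assert (Hvt : unit_radius vt) by (apply component_coef_unit_radius with 2; [lia|exact Hq]).
  assert (Hh : forall z, unit_disk z -> CPSeries vh z = (z * hypF a b (a + b) (z ^ 2))%C).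
  { intros z Hz; unfold vh, hypF.
    rewrite CPSeries_shift, <- CPSeries_in_square by assumption.
    fold F2; rewrite Cpow_1_r; reflexivity. }
  assert (Hdh : forall z, unit_disk z -> CPSeries (deriv_coef vh) z = CPSeries q z).
  { intros z Hz; unfold vh.
    rewrite (CPSeries_deriv_shift 0 F2 q); try assumption; [simpl; ring|].
    intros n; rewrite Nat.add_0_r; reflexivity. }
  assert (Hdg : forall z, unit_disk z ->
    CPSeries (deriv_coef vg) z = ((sqrt_alpha * z ^ k) ^ 2 * CPSeries q z)%C).
  { intros z Hz; unfold vg; rewrite Nat.add_1_r.
    rewrite (component_derivative _ _ _ 2 z Hq Hz); fold q.
    rewrite Cpow_mult_l, Halpha, <- Cpow_mult_r, (Nat.mul_comm k 2); reflexivity. }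
  assert (Hdt : forall z, unit_disk z ->
    CPSeries (deriv_coef vt) z = (sqrt_alpha * z ^ k * CPSeries q z)%C).
  { intros z Hz; unfold vt; rewrite Nat.add_1_r.
    exact (component_derivative _ _ _ 2 z Hq Hz). }
  assert (Hg : forall z, unit_disk z -> CPSeries vg z
    = (alpha * z ^ (2 * k + 1) / INR (2 * k + 1)
       * CPSeries (hadamard F2 (hyp_coef 2 (INR (2 * k + 1)) (INR (2 * k + 2)))) z)%C).
  { intros z Hz; replace (2 * k + 2)%nat with (2 * k + 1 + 1)%nat by lia.
    now apply component_series with 2; [lia|exact Hq|]. }
  assert (Ht : forall z, unit_disk z -> CPSeries vt z
    = (sqrt_alpha * z ^ (k + 1) / INR (k + 1)
       * CPSeries (hadamard F2 (hyp_coef 2 (INR (k + 1)) (INR (k + 2)))) z)%C).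
  { intros z Hz; replace (k + 2)%nat with (k + 1 + 1)%nat by lia.
    now apply component_series with 2; [lia|exact Hq|]. }
  assert (Hf : forall z, unit_disk z -> f z = (CPSeries vh z + Cconj (CPSeries vg z))%C)
    by (intros z Hz; rewrite Hh, Hg by exact Hz; reflexivity).
  assert (Ht' : forall z, unit_disk z -> t z = 2 * Im (CPSeries vt z) + c)
    by (intros z Hz; rewrite Ht by exact Hz; reflexivity).
  apply (isotropic_minimal_surface X
    (fun n => (1 * vh n + 1 * vg n)%C)
    (fun n => (- Ci * vh n + Ci * vg n)%C)
    (fun n => (- (2) * Ci * vt n)%C)).
  - now apply unit_radius_comb.
  - now apply unit_radius_comb.
  - now apply unit_radius_scal.
  - exists 0; intros z Hz.
    rewrite CPSeries_comb by assumption.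
    change (p1 (X z)) with (Re (f z)); rewrite Hf by exact Hz.
    destruct (CPSeries vh z), (CPSeries vg z); simpl; ring.
  - exists 0; intros z Hz.
    rewrite CPSeries_comb by assumption.
    change (p2 (X z)) with (Im (f z)); rewrite Hf by exact Hz.
    destruct (CPSeries vh z), (CPSeries vg z); simpl; ring.
  - exists c; intros z Hz.
    rewrite CPSeries_scal by assumption.
    change (p3 (X z)) with (t z); rewrite Ht' by exact Hz.
    destruct (CPSeries vt z); simpl; ring.
  - intros z Hz.
    rewrite !deriv_coef_comb, deriv_coef_scal, Hdh, Hdg, Hdt by assumption.
    generalize (CPSeries q z) (sqrt_alpha * z ^ k)%C; intros Q r.
    (* [(1 + r^2)^2 - (1 - r^2)^2 - 4 r^2 = 0], as an identity of polynomials
       in [Ci] too *)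
    transitivity ((1 + Ci * Ci) * Q ^ 2 * (1 + r ^ 2) ^ 2)%C; [|rewrite Ci_squared; ring].
    ring.
  - intros z Hz.
    rewrite !deriv_coef_comb, Hdh, Hdg by assumption.
    specialize (HQ z Hz); revert HQ.
    generalize (CPSeries q z) ((sqrt_alpha * z ^ k) ^ 2)%C; intros Q w HQ.
    destruct (Ceq_dec (1 * Q + 1 * (w * Q)) 0) as [H1|H1]; [right; left|now left].
    intros H2; apply HQ.
    assert (H2Q : (2 * Q = 0)%C).
    { replace (2 * Q)%C with ((1 * Q + 1 * (w * Q)) + Ci * (- Ci * Q + Ci * (w * Q))
        + (1 + Ci * Ci) * (Q - w * Q))%C by ring.
      rewrite H1, H2, Ci_squared; ring. }
    replace Q with (/ 2 * (2 * Q))%C by (field; apply RtoC_neq_0; lra).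
    rewrite H2Q; ring.
Qed.
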